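(* Let $d\ge 2$ be an integer, $q$ a power of a prime $p$ with $q\equiv 1\pmod d$, $t=\frac{q-1}{d}$, $T$ a generator of $\widehat{\mathbb F_q^{\times}}$, and $\lambda\in\mathbb F_q^\times$. Then \begin{align*} \#X_{\lambda}^d(\mathbb F_q)&=\frac{q^{d-1}-1}{q-1}+q^{d-2}\,{}_{d-1}F_{d-2}\left(\left.\begin{array}{cccc}T^t&T^{2t}&\ldots&T^{(d-1)t}\\ {}&\epsilon&\ldots&\epsilon\end{array}\right|\frac{1}{\lambda^d}\right)_q\\ &\quad+\frac1q\sum_{w\in W^{**}}\prod_{i=1}^d g(T^{w_it})+\frac{1}{q-1}\sum_{[w]\in W/\sim,\ [w]\neq[0]}\ \sum_{j=0}^{q-2}\frac{\prod_{i=1}^d g(T^{w_it+j})}{g(T^{dj})}\,T^{dj}(d\lambda). \end{align*}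
   Context: $X_\lambda^d$ is the Dwork hypersurface in $\mathbb P^{d-1}$ defined by $x_1^d+\cdots+x_d^d=d\lambda x_1x_2\cdots x_d$, and $\#X_\lambda^d(\mathbb F_q)$ its number of $\mathbb F_q$-rational points. $W$ is the set of $d$-tuples $w=(w_1,\dots,w_d)$ of integers with $0\le w_i<d$ and $\sum_i w_i\equiv0\pmod d$; $w\sim w'$ if $w-w'$ is congruent modulo $d$ to a multiple of $(1,\dots,1)$; the inner summand depends only on the class $[w]$, and $[0]$ is the class of $(0,\dots,0)$. $W^{**}\subset W$ is the set of tuples with all $w_i\ne0$ and the $w_i$ not all equal. Characters are extended by $\chi(0)=0$; $\epsilon$ is the trivial character. With $\mathrm{tr}:\mathbb F_q\to\mathbb F_p$ the trace, $\zeta$ a fixed primitive $p$-th root of unity and $\theta(x)=\zeta^{\mathrm{tr}(x)}$, the Gauss sum is $g(\chi)=\sum_{x\in\mathbb F_q}\chi(x)\theta(x)$. For characters $A,B$, $\binom{A}{B}:=\frac{B(-1)}{q}\sum_{x\in\mathbb F_q}A(x)\overline B(1-x)$, and Greene's function is ${}_{n+1}F_n\left(\left.\begin{array}{ccc}A_0&\ldots&A_n\\ &B_1\ldots&B_n\end{array}\right|x\right)_q:=\frac{q}{q-1}\sum_\chi\binom{A_0\chi}{\chi}\prod_{i=1}^n\binom{A_i\chi}{B_i\chi}\chi(x)$, summed over all characters $\chi$. *)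

(* Defs.v *)
From HB Require Import structures.
From mathcomp Require Import all_boot all_order all_algebra all_fingroup all_solvable all_field all_character.
Set Implicit Arguments. Unset Strict Implicit. Unset Printing Implicit Defensive.
Import Order.TTheory GRing.Theory Num.Theory.
Local Open Scope ring_scope.

Section Dwork.
Variable F : finFieldType.

Definition qF : nat := #|F|.

Definition is_mchar (chi : F -> algC) : Prop :=
  chi 0 = 0 /\ chi 1 = 1 /\ forall x y, chi (x * y) = chi x * chi y.

(* T generates the character group (of order q-1): its order is q-1 *)
Definition is_char_generator (T : F -> algC) : Prop :=
  is_mchar T /\
  forall k : nat, (forall x : F, x != 0 -> T x ^+ k = 1) -> (qF.-1 %| k)%N.

(* the k-th power of a character, with chi^k(0) = 0 (so T^0 = epsilon) *)
Definition chpow (chi : F -> algC) (k : nat) : F -> algC :=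
  fun x => if x == 0 then 0 else chi x ^+ k.

Definition eps : F -> algC := fun x => if x == 0 then 0 else 1.

Definition chmul (A B : F -> algC) : F -> algC := fun x => A x * B x.

(* All characters of F_q^x: the (linear) irreducible characters of the
   abelian group {unit F}, extended by 0 at 0. *)
Definition unitsG : {group {unit F}} := [set: {unit F}]%G.

Definition char_of (i : Iirr unitsG) : F -> algC :=
  fun x => if @insub F (fun y => y \is a GRing.unit) {unit F} x is Some u
           then 'chi[unitsG]_i u else 0.

(* absolute trace F_q -> F_p, with q = p^(logn p q) *)
Definition trF (p : nat) (x : F) : F := \sum_(i < logn p qF) x ^+ (p ^ i).

Definition tr_nat (p : nat) (x : F) : nat :=
  if [pick k : 'I_p | (k%:R : F) == trF p x] is Some k then val k else 0%N.

Definition theta (p : nat) (zeta : algC) (x : F) : algC := zeta ^+ tr_nat p x.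

Definition gauss (p : nat) (zeta : algC) (chi : F -> algC) : algC :=
  \sum_(x : F) chi x * theta p zeta x.

Definition jbinom (A B : F -> algC) : algC :=
  B (-1) / (qF%:R) * \sum_(x : F) A x * (B (1 - x))^*.

(* Greene's function {}_{n+1}F_n (A_0 ... A_n ; B_1 ... B_n | x)_q, with
   A i for i : 'I_n.+1 and B_(k+1) = B k for k : 'I_n. *)
Definition greeneF (n : nat) (A : 'I_n.+1 -> F -> algC) (B : 'I_n -> F -> algC)
    (x : F) : algC :=
  qF%:R / (qF%:R - 1) *
  \sum_(i : Iirr unitsG)
     (jbinom (chmul (A ord0) (char_of i)) (char_of i) *
      \prod_(k < n) jbinom (chmul (A (lift ord0 k)) (char_of i))
                           (chmul (B k) (char_of i)) *
      char_of i x).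

(* number of F-points of x_1^d + ... + x_d^d = d lambda x_1 ... x_d in P^(d-1):
   points are counted via the unique representative whose first nonzero
   coordinate equals 1. *)
Definition proj_normalized (d : nat) (x : {ffun 'I_d -> F}) : bool :=
  [exists i, (x i == 1) && [forall j : 'I_d, ((j < i)%N) ==> (x j == 0)]].

Definition dwork_count (d : nat) (lam : F) : nat :=
  #|[set x : {ffun 'I_d -> F} | proj_normalized x &&
      (\sum_i x i ^+ d == d%:R * lam * \prod_i x i)]|.

End Dwork.

Definition Wset (d : nat) : {set {ffun 'I_d -> 'I_d}} :=
  [set w : {ffun 'I_d -> 'I_d} | ((\sum_i (w i : nat)) %% d == 0)%N].

Definition Wequiv (d : nat) (w w' : {ffun 'I_d -> 'I_d}) : bool :=
  [exists c : 'I_d, [forall i, ((w' i + c) %% d == (w i : nat) %% d)%N]].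

Definition Wclass (d : nat) (w : {ffun 'I_d -> 'I_d}) : {set {ffun 'I_d -> 'I_d}} :=
  [set w' in Wset d | Wequiv w w'].

Definition Wclasses (d : nat) : {set {set {ffun 'I_d -> 'I_d}}} :=
  [set Wclass w | w in Wset d].

Definition is_zero_class (d : nat) (C : {set {ffun 'I_d -> 'I_d}}) : bool :=
  [exists w in C, [forall i, (w i : nat) == 0%N]].

Definition Wss (d : nat) : {set {ffun 'I_d -> 'I_d}} :=
  [set w in Wset d | [forall i, (w i : nat) != 0%N] &&
                     ~~ [forall i, forall j, w i == w j]].

Definition sum_classes (d : nat) (P : pred {set {ffun 'I_d -> 'I_d}})
    (f : {ffun 'I_d -> 'I_d} -> algC) : algC :=
  \sum_(C in Wclasses d | P C)
     (if [pick w in C] is Some w then f w else 0).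

(* Main.v *)
Require Import Defs.
From HB Require Import structures.
From mathcomp Require Import all_boot all_order all_algebra all_fingroup.
From mathcomp Require Import all_solvable all_field all_character.
From mathcomp Require Import ring.
Import Order.TTheory GRing.Theory Num.Theory.
Set Implicit Arguments.
Unset Strict Implicit.
Unset Printing Implicit Defensive.
Local Open Scope ring_scope.

(* Detecting the equation of the hypersurface with an additive character and
   expanding in multiplicative characters writes the point count as a sum of
   products of Gauss sums indexed by the pairs (w, j), with w in W and j modulo
   q - 1. The class [0], together with the nonzero constant tuples coming from
   the Fermat cone, is Greene's function: its binomials are Jacobi sums, and
   their product collapses by the Hasse-Davenport product formula.

   The product formula comes from L-series over F[u]. For a multiplicative
   character chi and an additive character psi of F, mapping a monic f to
   chi(product of the roots)^d psi(sum of the d-th powers of the roots) is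
   multiplicative, so the logarithmic derivative of its L-series is a sum over
   points of the finite extensions of F. Grouping these points by their d-th
   powers factors the L-series as the product over i < d of 1 + g(chi rho^i) t,
   with rho of order d. By Newton's identities, for f of degree d the sum of the
   d-th powers of the roots is -d f(0) plus a term that does not involve f(0),
   so the coefficient of t^d is chi(d)^(-d) g(chi^d) times a constant not
   depending on chi, which the trivial character determines. *)

(** * Periods and periodic sums *)

Section Period.
Variables (T : eqType) (f : T -> T).
Hypothesis f_inj : injective f.
Implicit Types (x y : T) (j k l m : nat).

Lemma iter_inj j : injective (iter j f).
Proof. by elim: j => // j IHj x y /f_inj/IHj. Qed.

Lemma nonuniq_traject_period x m :
  ~~ uniq (traject f x m.+1) -> exists2 l, (0 < l <= m)%N & iter l f x = x.
Proof.
rewrite looping_uniq negbK => /trajectP[i lt_im eq_im].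
exists (m - i)%N; first by rewrite subn_gt0 lt_im leq_subr.
by apply: (iter_inj (j := i)); rewrite -iterD subnKC // ltnW.
Qed.

Lemma iter_mul_period x j l : iter l f x = x -> iter (j * l) f x = x.
Proof. by move=> fx; elim: j => // j IHj; rewrite mulSn iterD IHj. Qed.

Definition minimal_period x l :=
  forall k, (iter k f x == x) = (l %| k)%N.

Lemma exists_minimal_period x m : ~~ uniq (traject f x m.+1) ->
  exists2 l, (0 < l)%N & minimal_period x l.
Proof.
move=> /nonuniq_traject_period[l1 /andP[l1_gt0 _] /eqP fx1].
have ex_period : exists l, (0 < l)%N && (iter l f x == x).
  by exists l1; rewrite l1_gt0.
case: (ex_minnP ex_period) => l /andP[l_gt0 /eqP fx] l_min.
exists l => // k; rewrite {1}(divn_eq k l) addnC iterD iter_mul_period //.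
rewrite /dvdn; case: posnP => [-> | r_gt0]; first by rewrite eqxx.
apply: contraTF (ltn_pmod k l_gt0) => fxr.
by rewrite -leqNgt l_min // r_gt0.
Qed.

Lemma uniq_traject_minimal_period x l :
  minimal_period x l -> uniq (traject f x l).
Proof.
case: l => // l x_period; apply/negPn/negP.
case/nonuniq_traject_period=> k /andP[k_gt0 le_kl] /eqP.
by rewrite x_period gtnNdvd.
Qed.

Lemma count_traject_mul x y j l : iter l f x = x ->
  count_mem y (traject f x (j * l)) = (j * count_mem y (traject f x l))%N.
Proof.
by move=> fx; elim: j => // j IHj; rewrite !mulSn trajectD count_cat fx IHj.
Qed.

End Period.

Lemma count_dvd_leq_mul (l a m : nat) : (0 < l)%N -> (a * l <= m)%N ->
  (\sum_(1 <= k < m.+1) ((l %| k) && (k <= a * l)) = a)%N.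
Proof.
move=> l_gt0 le_am; rewrite -[RHS](mulnK a l_gt0) divn_count_dvd.
rewrite [RHS](big_nat_widen _ _ m.+1) // [RHS]big_mkcond /=.
by apply: eq_bigr => k _; rewrite ltnS andbC; case: (k <= _)%N.
Qed.

Lemma sum_comp_count (I J : eqType) (V : nmodType) (r : seq I) (s : seq J)
    (f : I -> J) (h : J -> V) :
  uniq s -> {in r, forall x, f x \in s} ->
  \sum_(x <- r) h (f x) = \sum_(y <- s) h y *+ count (fun x => f x == y) r.
Proof.
move=> s_uniq f_s; transitivity (\sum_(y <- s) \sum_(x <- r | f x == y) h y).
  rewrite (exchange_big_dep xpredT) //=; apply: eq_big_seq => x /f_s fx_s.
  under eq_bigl do rewrite eq_sym.
  by rewrite -big_filter filter_pred1_uniq // big_seq1.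
by apply: eq_bigr => y _; rewrite big_const_seq iter_addr_0.
Qed.

Lemma sum_ord_dvd (V : nmodType) (N n l : nat) (h : nat -> V) :
  N = (n * l)%N -> (0 < l)%N ->
  \sum_(k < N | (l %| k)%N) h k = \sum_(j < n) h (j * l)%N.
Proof.
move=> -> l_gt0.
rewrite -(big_mkord (fun k => l %| k)%N h) big_mkcond big_nat_mul.
rewrite big_mkord; apply: eq_bigr => j _.
have lt_jl : (j * l < j.+1 * l)%N by rewrite ltn_pmul2r.
rewrite big_ltn // dvdn_mull //= big_nat big1 ?addr0 // => k /andP[lt_jk lt_kj].
case: dvdnP => // -[i k_eq]; move: lt_jk lt_kj.
by rewrite k_eq !ltn_pmul2r // ltnS ltnNge => /negPf ->.
Qed.

Definition periodic (A : Type) (N : nat) (f : nat -> A) :=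
  forall k l, k = l %[mod N] -> f k = f l.

Lemma sum_periodic_shift (V : nmodType) N (f : nat -> V) s : periodic N f ->
  \sum_(j < N) f (j + s)%N = \sum_(j < N) f j.
Proof.
case: N => [|N] f_per; first by rewrite !big_ord0.
rewrite [RHS](reindex_inj (addIr (inZp s))) /=.
by apply: eq_bigr => j _; apply: f_per; rewrite modnDmr modn_mod.
Qed.

Lemma sum_periodic_mul (V : nmodType) N d t (f : nat -> V) :
  N = (d * t)%N -> periodic t f -> \sum_(j < N) f j = (\sum_(j < t) f j) *+ d.
Proof.
move=> -> f_per; rewrite -(big_mkord xpredT f) big_nat_mul.
rewrite -[X in _ *+ X]subn0 -sumr_const_nat; apply: eq_bigr => i _.
rewrite -[(i * t)%N]add0n big_addn mulSn addnK big_mkord.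
by apply: eq_bigr => j _; apply: f_per; rewrite addnC modnMDl.
Qed.

Lemma sum_periodic_dvd (V : nmodType) N d (f : nat -> V) :
  (0 < d)%N -> (d %| N)%N -> periodic N f ->
  (\sum_(k < N | (d %| k)%N) f k) *+ d = \sum_(j < N) f (d * j)%N.
Proof.
move=> d_gt0 /dvdnP[t ->] f_per.
have fd_per : periodic t (fun j => f (d * j)%N).
  by move=> k l eq_kl; apply: f_per; rewrite [(t * d)%N]mulnC -!muln_modr eq_kl.
rewrite (sum_periodic_mul (mulnC t d) fd_per) (sum_ord_dvd _ erefl) //.
congr (_ *+ _).
by apply: eq_bigr => j _; rewrite mulnC.
Qed.

(** * Logarithmic derivatives and Newton's identities *)

Section LogDerivative.
Variable R : comNzRingType.
Implicit Types (P Q : {poly R}) (S c : nat -> R) (rs ss : seq R).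

(* [X S' = C S] for the formal power series [S = \sum_m S_m X^m] and
   [C = \sum_(k >= 1) c_k X^k]. *)
Definition has_logderiv S c :=
  forall m, S m *+ m = \sum_(1 <= k < m.+1) c k * S (m - k)%N.

Definition trunc_series (M : nat) c : {poly R} :=
  \poly_(k < M) (if k == 0%N then 0 else c k).

Lemma coef_trunc_seriesM M c P m : (m < M)%N ->
  (trunc_series M c * P)`_m = \sum_(1 <= k < m.+1) c k * P`_(m - k).
Proof.
move=> lt_mM; rewrite coefM big_ord_recl coef_poly (leq_ltn_trans _ lt_mM) //=.
rewrite mul0r add0r (big_addn 0 m.+1 1) subn1 big_mkord; apply: eq_bigr => j _.
by rewrite coef_poly addn1 (leq_ltn_trans _ lt_mM).
Qed.

Lemma has_logderiv_polyP P c : has_logderiv (nth 0 P) c <->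
  forall m M, (m < M)%N -> ('X * P^`() - trunc_series M c * P)`_m = 0.
Proof.
have coefXderiv m : ('X * P^`())`_m = P`_m *+ m.
  by rewrite coefXM; case: m => // m; rewrite coef_deriv.
split=> [P_logderiv m M lt_mM | P_poly m].
  by rewrite coefB coefXderiv coef_trunc_seriesM // P_logderiv subrr.
apply/eqP; rewrite -coefXderiv -subr_eq0 -(coef_trunc_seriesM _ _ (ltnSn m)).
by rewrite -coefB P_poly.
Qed.

Lemma coefM_eq0 M P Q : (forall m, (m < M)%N -> P`_m = 0) ->
  forall m, (m < M)%N -> (P * Q)`_m = 0.
Proof.
move=> P0 m lt_mM; rewrite coefM big1 // => j _.
by rewrite P0 ?mul0r // (leq_trans (ltn_ord j)).
Qed.

Lemma has_logderivM P Q c c' :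
  has_logderiv (nth 0 P) c -> has_logderiv (nth 0 Q) c' ->
  has_logderiv (nth 0 (P * Q)) (fun k => c k + c' k).
Proof.
move=> /has_logderiv_polyP P_c /has_logderiv_polyP Q_c'.
apply/has_logderiv_polyP => m M lt_mM.
have -> : trunc_series M (fun k => c k + c' k) =
    trunc_series M c + trunc_series M c'.
  apply/polyP => k; rewrite coefD !coef_poly.
  by case: (k < M)%N; case: (k == 0)%N; rewrite ?addr0.
have -> : 'X * (P * Q)^`() - (trunc_series M c + trunc_series M c') * (P * Q) =
    ('X * P^`() - trunc_series M c * P) * Q +
    ('X * Q^`() - trunc_series M c' * Q) * P by rewrite derivM; ring.
by rewrite coefD !(@coefM_eq0 M) ?addr0 // => i; [apply: Q_c' | apply: P_c].
Qed.

Lemma has_logderiv_prod (I : Type) (r : seq I) (P : I -> {poly R})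
    (c : I -> nat -> R) :
  (forall i, has_logderiv (nth 0 (P i)) (c i)) ->
  has_logderiv (nth 0 (\prod_(i <- r) P i)) (fun k => \sum_(i <- r) c i k).
Proof.
move=> P_c; elim: r => [|i r IHr] m.
  rewrite big_nil coef1 big1 => [|k _]; last by rewrite big_nil mul0r.
  by case: m => [|m]; rewrite ?mul0rn.
rewrite big_cons (has_logderivM (P_c i) IHr).
by apply: eq_bigr => k _; rewrite big_cons.
Qed.

Definition recip_prod rs : {poly R} := \prod_(a <- rs) (1 - a *: 'X).

Lemma has_logderiv_1subMX a :
  has_logderiv (nth 0 (1 - a *: 'X : {poly R})) (fun k => - a ^+ k).
Proof.
have coef_lin j : (1 - a *: 'X : {poly R})`_j =
    if j == 0%N then 1 else if j == 1%N then - a else 0.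
  rewrite coefB coefZ coef1 coefX.
  by case: j => [|[|j]]; rewrite ?mulr0 ?mulr1 ?subr0 ?sub0r.
case=> [|m]; first by rewrite big_geq.
rewrite big_nat_recr //= subnn !coef_lin /= mulr1; case: m => [|m].
  by rewrite big_geq // add0r.
rewrite mul0rn big_nat_recr //= subSnn coef_lin big_nat big1 => [|k].
  by rewrite add0r mulrNN -exprSr subrr.
case/andP=> _ lt_km; have: (1 < m.+2 - k)%N by rewrite ltn_subRL addn1.
by rewrite coef_lin; case: (m.+2 - k)%N => [|[|?]]; rewrite ?mulr0.
Qed.

Lemma coef_recip_prod rs i : (recip_prod rs)`_i =
  if (i <= size rs)%N then (\prod_(a <- rs) ('X - a%:P))`_(size rs - i) else 0.
Proof.
rewrite /recip_prod; elim: rs i => [|a rs IHrs] i.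
  by rewrite !big_nil !coef1 leqn0; case: eqP => // ->.
rewrite !big_cons !mulrBl mul1r -scalerAl !coefB coefZ coefCM !coefXM /=.
case: i => [|i]; rewrite !IHrs.
  rewrite mulr0 !subn0 [X in a * X]nth_default ?size_prod_XsubC //.
  by rewrite mulr0.
rewrite subSS subn_eq0 ltnS [(size rs <= i)%N]leqNgt if_neg /=.
case: ifP => [lt_i | _]; first by rewrite ltnW // -subnS.
by case: ifP; rewrite // mulr0 subr0.
Qed.

Lemma coef0_recip_prod rs : (recip_prod rs)`_0 = 1.
Proof.
rewrite coef_recip_prod subn0; have /monicP := monic_prod_XsubC rs xpredT id.
by rewrite /lead_coef size_prod_XsubC.
Qed.

Lemma newton_identities rs :
  has_logderiv (nth 0 (recip_prod rs)) (fun k => \sum_(a <- rs) - a ^+ k).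
Proof. by apply: has_logderiv_prod => a; apply: has_logderiv_1subMX. Qed.

Lemma logderiv_recr S c m : has_logderiv S c -> S 0%N = 1 ->
  c m.+1 = S m.+1 *+ m.+1 - \sum_(1 <= k < m.+1) c k * S (m.+1 - k)%N.
Proof.
move=> -> S0; rewrite big_nat_recr //= subnn S0 mulr1.
by rewrite [X in X - _]addrC addrK.
Qed.

Lemma logderivB_first_difference S S' c c' n :
  has_logderiv S c -> has_logderiv S' c' -> S 0%N = 1 ->
  (forall i, (i < n)%N -> S' i = S i) -> (0 < n)%N ->
  c' n - c n = (S' n - S n) *+ n.
Proof.
move=> S_c S'_c' S0 S'_S n_gt0.
have S'0 : S' 0%N = 1 by rewrite S'_S.
have c'_c k : (0 < k < n)%N -> c' k = c k.
  elim/ltn_ind: k => -[|k] // IHk lt_kn.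
  rewrite (logderiv_recr _ S_c) // (logderiv_recr _ S'_c') // S'_S //.
  congr (_ - _); apply: eq_big_nat => j /andP[j_gt0 lt_jk].
  rewrite IHk // ?j_gt0 ?(ltn_trans lt_jk) // S'_S //.
  by rewrite (leq_ltn_trans (leq_subr _ _)).
case: n n_gt0 S'_S c'_c => // n _ S'_S c'_c.
rewrite (logderiv_recr _ S_c) // (logderiv_recr _ S'_c') //.
rewrite (eq_big_nat _ _ (F2 := fun k => c k * S (n.+1 - k)%N)) => [|k k_n].
  by rewrite mulrnBl; ring.
by rewrite c'_c // S'_S // ltn_subrL; case/andP: k_n => ->.
Qed.

Lemma power_sum_addC rs ss (b : R) n :
  size rs = n -> size ss = n -> (0 < n)%N ->
  \prod_(a <- ss) ('X - a%:P) = \prod_(a <- rs) ('X - a%:P) + b%:P ->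
  \sum_(a <- ss) a ^+ n = \sum_(a <- rs) a ^+ n - b *+ n.
Proof.
move=> rs_n ss_n n_gt0 ss_rs.
have := logderivB_first_difference (newton_identities rs) (newton_identities ss)
  (coef0_recip_prod rs) _ n_gt0.
rewrite !coef_recip_prod ss_rs rs_n ss_n leqnn subnn coefD coefC eqxx.
rewrite [X in X *+ n]addrAC subrr add0r => Newton.
apply: oppr_inj; rewrite opprB -addrC -Newton => [|i lt_in].
  by rewrite !sumrN addrC subrK.
rewrite !coef_recip_prod ss_rs rs_n ss_n ltnW // coefD coefC.
by rewrite subn_eq0 leqNgt lt_in addr0.
Qed.

End LogDerivative.

Lemma has_logderiv_unique (R : numDomainType) (S S' c c' : nat -> R) :
  has_logderiv S c -> has_logderiv S' c' -> S 0%N = S' 0%N ->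
  (forall k, (0 < k)%N -> c k = c' k) -> S =1 S'.
Proof.
move=> S_c S'_c' S0 c_c'; elim/ltn_ind => -[|m] IHm //.
apply: (@pmulrnI _ m.+1) => //; rewrite S_c S'_c'.
apply: eq_big_nat => k /andP[k_gt0 _].
by rewrite c_c' // IHm // ltn_subrL k_gt0.
Qed.

(** * Characters of finite fields *)

Lemma fixed_mulr_eq0 (R : idomainType) (u S : R) :
  u != 1 -> S = u * S -> S = 0.
Proof.
move=> u_neq1 /eqP; rewrite -{1}[S]mul1r -subr_eq0 -mulrBl mulf_eq0 subr_eq0.
by rewrite eq_sym (negPf u_neq1) => /eqP.
Qed.

Lemma sum_unity_root (R : idomainType) (u : R) n : u ^+ n = 1 ->
  \sum_(i < n) u ^+ i = if u == 1 then n%:R else 0.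
Proof.
move=> un1; case: eqVneq => [-> | u_neq1].
  by under eq_bigr do rewrite expr1n; rewrite sumr_const card_ord.
have /esym/eqP := subrX1 u n.
by rewrite un1 subrr mulf_eq0 subr_eq0 (negPf u_neq1) => /eqP.
Qed.

Section FiniteField.
Variable F : finFieldType.
Local Notation N := (#|F|.-1).

Lemma finField_card_gt0 : (0 < #|F|)%N.
Proof. exact: ltnW (finNzRing_gt1 F). Qed.

Lemma finField_pred_card_gt0 : (0 < N)%N.
Proof. by rewrite -ltnS prednK ?finNzRing_gt1 ?finField_card_gt0. Qed.

Lemma expf_pred_card (x : F) : x != 0 -> x ^+ N = 1.
Proof.
move=> x_neq0; apply: (mulfI x_neq0).
by rewrite -exprS prednK ?finField_card_gt0 // expf_card mulr1.
Qed.

Lemma finField_prim_root : {g : F | N.-primitive_root g}.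
Proof.
apply: sigW.
have /hasP[g _ g_prim] : has N.-primitive_root (rem (0 : F) (enum F)).
  apply: has_prim_root; rewrite ?rem_uniq ?enum_uniq ?finField_pred_card_gt0 //.
    apply/allP => x; rewrite mem_rem_uniq ?enum_uniq // inE => /andP[x_neq0 _].
    by rewrite unity_rootE expf_pred_card.
  by rewrite size_rem ?mem_enum // -cardE.
by exists g.
Qed.

Lemma prim_root_pred_card_neq0 (g : F) : N.-primitive_root g -> g != 0.
Proof.
by move=> g_prim; rewrite (prim_root_eq0 g_prim) -lt0n finField_pred_card_gt0.
Qed.

Lemma dvdn_pred_card_gt0 d : (d %| N)%N -> (0 < d)%N.
Proof. exact: dvdn_gt0 finField_pred_card_gt0. Qed.

Lemma divn_pred_card_gt0 d : (d %| N)%N -> (0 < N %/ d)%N.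
Proof.
move=> d_dvd; rewrite divn_gt0 ?dvdn_pred_card_gt0 //.
exact: dvdn_leq finField_pred_card_gt0 d_dvd.
Qed.

Lemma natr_dvd_pred_card_neq0 d : (d %| N)%N -> d%:R != 0 :> F.
Proof.
have [g g_prim] := finField_prim_root => d_dvd.
exact: prim_root_natf_neq0 (dvdn_prim_root g_prim d_dvd).
Qed.

Lemma natr_card_neq0 : #|F|%:R != 0 :> algC.
Proof. by rewrite pnatr_eq0 -lt0n finField_card_gt0. Qed.

Lemma natr_pred_card : N%:R = #|F|%:R - 1 :> algC.
Proof. by rewrite -{2}(prednK finField_card_gt0) -natr1 addrK. Qed.

Lemma natr_pred_card_neq0 : N%:R != 0 :> algC.
Proof. by rewrite pnatr_eq0 -lt0n finField_pred_card_gt0. Qed.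

End FiniteField.

Section MultiplicativeCharacter.
Variable F : finFieldType.
Implicit Types (chi rho : F -> algC) (x y : F) (k : nat).
Local Notation N := (#|F|.-1).

Definition nontrivial_mchar chi := [exists x : F, (x != 0) && (chi x != 1)].

Definition chconj chi : F -> algC := fun x => (chi x)^*.

Lemma is_mchar_eps : is_mchar (@eps F).
Proof.
rewrite /eps; split; first by rewrite eqxx.
split=> [|x y]; first by rewrite oner_eq0.
by rewrite mulf_eq0; case: eqP; case: eqP; rewrite ?mul0r ?mul1r ?mulr0.
Qed.

Lemma is_mchar_chmul chi rho : is_mchar chi -> is_mchar rho ->
  is_mchar (chmul chi rho).
Proof.
case=> chi0 [chi1 chiM] [_ [rho1 rhoM]]; rewrite /chmul; split.
  by rewrite chi0 mul0r.
by split=> [|x y]; rewrite ?chi1 ?rho1 ?mulr1 // chiM rhoM mulrACA.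
Qed.

Lemma is_mchar_chpow chi k : is_mchar chi -> is_mchar (chpow chi k).
Proof.
case=> _ [chi1 chiM]; rewrite /chpow; split; first by rewrite eqxx.
split=> [|x y]; first by rewrite oner_eq0 chi1 expr1n.
rewrite mulf_eq0; case: eqP => [|_]; first by rewrite mul0r.
by case: eqP => [|_]; rewrite ?mulr0 // chiM exprMn.
Qed.

Lemma is_mchar_chconj chi : is_mchar chi -> is_mchar (chconj chi).
Proof.
case=> chi0 [chi1 chiM]; rewrite /chconj; split; first by rewrite chi0 conjC0.
by split=> [|x y]; rewrite ?chi1 ?conjC1 // chiM rmorphM.
Qed.

Lemma chpowE chi k x : x != 0 -> chpow chi k x = chi x ^+ k.
Proof. by rewrite /chpow => /negPf ->. Qed.

Lemma chpow_at0 chi k : chpow chi k 0 = 0.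
Proof. by rewrite /chpow eqxx. Qed.

Lemma chpowD chi k l : chpow chi (k + l) =1 chmul (chpow chi k) (chpow chi l).
Proof.
by move=> x; rewrite /chmul /chpow; case: eqP; rewrite ?mul0r // exprD.
Qed.

Lemma chpow_chpow chi k l : chpow (chpow chi k) l =1 chpow chi (k * l).
Proof. by move=> x; rewrite /chpow; case: eqP => // _; rewrite exprM. Qed.

Lemma chpow_chconj chi k : chpow (chconj chi) k =1 chconj (chpow chi k).
Proof.
by move=> x; rewrite /chconj /chpow; case: eqP => _; rewrite ?conjC0 ?rmorphXn.
Qed.

Lemma chmul_eps chi : is_mchar chi -> chmul chi (@eps F) =1 chi.
Proof.
case=> chi0 _ x; rewrite /chmul /eps.
by case: eqP => [-> | _]; rewrite ?chi0 ?mulr0 ?mulr1.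
Qed.

Lemma chpow_eps chi k : chi =1 @eps F -> chpow chi k =1 @eps F.
Proof.
by move=> chi_eps x; rewrite /chpow chi_eps /eps; case: eqP; rewrite ?expr1n.
Qed.

Lemma chconj_eps chi : chi =1 @eps F -> chconj chi =1 @eps F.
Proof.
move=> chi_eps x; rewrite /chconj chi_eps /eps.
by case: eqP; rewrite ?conjC0 ?conjC1.
Qed.

Section Character.
Variable chi : F -> algC.
Hypothesis chi_mchar : is_mchar chi.

Lemma mchar0 : chi 0 = 0.
Proof. by case: chi_mchar. Qed.

Lemma mchar1 : chi 1 = 1.
Proof. by case: chi_mchar => _ []. Qed.

Lemma mcharM x y : chi (x * y) = chi x * chi y.
Proof. by case: chi_mchar => _ []. Qed.

Lemma mcharX x k : chi (x ^+ k) = chi x ^+ k.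
Proof. by elim: k => [|k IHk]; rewrite ?mchar1 // !exprS mcharM IHk. Qed.

Lemma mchar_prod (I : finType) (x : I -> F) :
  chi (\prod_i x i) = \prod_i chi (x i).
Proof. exact: (big_morph chi mcharM mchar1). Qed.

Lemma mchar_unity x : x != 0 -> chi x ^+ N = 1.
Proof. by move=> x_neq0; rewrite -mcharX expf_pred_card // mchar1. Qed.

Lemma mchar_neq0 x : x != 0 -> chi x != 0.
Proof.
move=> x_neq0; have := oner_neq0 algC; rewrite -(mchar_unity x_neq0).
by rewrite expf_eq0 finField_pred_card_gt0.
Qed.

Lemma mcharV x : chi x^-1 = (chi x)^-1.
Proof.
have [-> | x_neq0] := eqVneq x 0; first by rewrite invr0 mchar0 invr0.
apply: (mulfI (mchar_neq0 x_neq0)).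
by rewrite -mcharM !divff ?mchar1 ?mchar_neq0.
Qed.

Lemma mcharN1_sqr : chi (-1) * chi (-1) = 1.
Proof. by rewrite -mcharM mulrNN mulr1 mchar1. Qed.

Lemma mcharN1_inv : (chi (-1))^-1 = chi (-1).
Proof. by rewrite -mcharV invrN1. Qed.

Lemma mcharN1_neq0 : chi (-1) != 0.
Proof. by rewrite mchar_neq0 // oppr_eq0 oner_eq0. Qed.

Lemma mcharN x : chi (- x) = chi (-1) * chi x.
Proof. by rewrite -mcharM mulN1r. Qed.

Lemma chconjE x : chconj chi x = (chi x)^-1.
Proof.
rewrite /chconj; have [-> | x_neq0] := eqVneq x 0.
  by rewrite mchar0 conjC0 invr0.
have norm1 : `|chi x| = 1.
  apply/eqP; rewrite -(@pexpr_eq1 _ _ N) ?finField_pred_card_gt0 //.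
  by rewrite -normrX mchar_unity // normr1.
by rewrite invC_norm norm1 expr1n invr1 mul1r.
Qed.

Lemma chpowE_gt0 k x : (0 < k)%N -> chpow chi k x = chi x ^+ k.
Proof.
by rewrite /chpow; case: eqP => // -> k_gt0; rewrite mchar0 expr0n gtn_eqF.
Qed.

Lemma trivial_mcharE : ~~ nontrivial_mchar chi -> chi =1 @eps F.
Proof.
move=> /existsPn chi_triv x; rewrite /eps; have := chi_triv x.
by case: eqP => [-> _ | _]; [rewrite mchar0 | rewrite negbK => /eqP].
Qed.

Lemma sum_nontrivial_mchar : nontrivial_mchar chi -> \sum_x chi x = 0.
Proof.
case/existsP=> a /andP[a_neq0 /fixed_mulr_eq0]; apply.
rewrite mulr_sumr (reindex_inj (mulfI a_neq0)).
by apply: eq_bigr => x _; apply: mcharM.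
Qed.

End Character.

Lemma eq_nontrivial_mchar chi rho : chi =1 rho ->
  nontrivial_mchar chi = nontrivial_mchar rho.
Proof. by move=> eq_chi; apply: eq_existsb => x; rewrite eq_chi. Qed.

Lemma sum_eps : \sum_x @eps F x = N%:R.
Proof.
rewrite (bigD1 0) //= /eps eqxx add0r -(cardC1 (0 : F)) -sumr_const.
by apply: eq_bigr => x /negPf ->.
Qed.

End MultiplicativeCharacter.

(** * Gauss sums *)

Section GaussSum.
Variables (F : finFieldType) (psi : F -> algC).
Implicit Types (chi rho : F -> algC) (a x y : F).
Local Notation q := (#|F|%:R : algC).
Local Notation N := (#|F|.-1).

Definition nontrivial_achar := [/\ psi 0 = 1,
  forall x y, psi (x + y) = psi x * psi y & exists x, psi x != 1].

Definition gsum chi : algC := \sum_x chi x * psi x.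

Lemma eq_gsum chi rho : chi =1 rho -> gsum chi = gsum rho.
Proof. by move=> eq_chi; apply: eq_bigr => x _; rewrite eq_chi. Qed.

Hypothesis psi_achar : nontrivial_achar.

Lemma achar0 : psi 0 = 1.
Proof. by case: psi_achar. Qed.

Lemma acharD x y : psi (x + y) = psi x * psi y.
Proof. by case: psi_achar. Qed.

Lemma achar_sum (I : finType) (x : I -> F) :
  psi (\sum_i x i) = \prod_i psi (x i).
Proof. exact: (big_morph psi acharD achar0). Qed.

Lemma sum_achar : \sum_x psi x = 0.
Proof.
case: psi_achar => _ _ [a /fixed_mulr_eq0]; apply.
rewrite mulr_sumr (reindex_inj (addrI a)).
by apply: eq_bigr => x _; apply: acharD.
Qed.

Lemma sum_achar_scale a : \sum_x psi (a * x) = if a == 0 then q else 0.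
Proof.
case: eqVneq => [-> | a_neq0].
  by under eq_bigr do rewrite mul0r achar0; rewrite sumr_const.
by rewrite -[RHS]sum_achar [RHS](reindex_inj (mulfI a_neq0)).
Qed.

Lemma gsum_eps : gsum (@eps F) = -1.
Proof.
have /eqP := sum_achar; rewrite (bigD1 0) //= achar0 addrC addr_eq0 => /eqP <-.
rewrite /gsum (bigD1 0) //= /eps eqxx mul0r add0r.
by apply: eq_bigr => x /negPf ->; rewrite mul1r.
Qed.

Lemma gsum_units chi : is_mchar chi ->
  gsum chi = \sum_(x | x != 0) chi x * psi x.
Proof.
by move=> chi_mchar; rewrite /gsum (bigD1 0) //= mchar0 // mul0r add0r.
Qed.

Lemma gsum_scale chi a : is_mchar chi -> a != 0 ->
  \sum_x chi x * psi (a * x) = (chi a)^-1 * gsum chi.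
Proof.
move=> chi_mchar a_neq0.
rewrite /gsum [in RHS](reindex_inj (mulfI a_neq0)) mulr_sumr.
apply: eq_bigr => x _ /=.
by rewrite (mcharM chi_mchar) -mulrA mulKf ?mchar_neq0.
Qed.

Lemma gsum_mul_chconj chi : is_mchar chi -> nontrivial_mchar chi ->
  gsum chi * gsum (chconj chi) = chi (-1) * q.
Proof.
move=> chi_mchar chi_nontriv; have chi'_mchar := is_mchar_chconj chi_mchar.
have sum_units z : \sum_(y | y != 0) psi (y * (z + 1)) =
    (if z == -1 then q else 0) - 1.
  rewrite -addr_eq0 -sum_achar_scale [in RHS](bigD1 0) //= mulr0 achar0.
  rewrite [1 + _]addrC addrK.
  by apply: eq_bigr => y _; rewrite mulrC.
transitivity (\sum_z chi z * ((if z == -1 then q else 0) - 1)).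
  rewrite [X in _ * X]gsum_units // mulr_sumr.
  under [RHS]eq_bigr do rewrite -sum_units mulr_sumr.
  rewrite exchange_big; apply: eq_bigr => y y_neq0 /=.
  under [RHS]eq_bigr do rewrite mulrDr mulr1 acharD mulrA.
  by rewrite -mulr_suml gsum_scale // chconjE //; ring.
under eq_bigr do rewrite mulrBr mulr1.
rewrite sumrB (sum_nontrivial_mchar chi_mchar) // subr0.
rewrite (bigD1 (-1)) //= eqxx big1 ?addr0 //.
by move=> z /negPf ->; rewrite mulr0.
Qed.

Lemma gsum_neq0 chi : is_mchar chi -> gsum chi != 0.
Proof.
move=> chi_mchar.
have [chi_nontriv | chi_triv] := boolP (nontrivial_mchar chi).
  have /eqP := gsum_mul_chconj chi_mchar chi_nontriv; apply: contraTneq => ->.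
  by rewrite mul0r eq_sym mulf_neq0 ?natr_card_neq0 ?mcharN1_neq0.
by rewrite (eq_gsum (trivial_mcharE _ chi_triv)) // gsum_eps oppr_eq0 oner_eq0.
Qed.

Lemma gsum_chconjV chi : is_mchar chi -> nontrivial_mchar chi ->
  (gsum (chconj chi))^-1 = chi (-1) * gsum chi / q.
Proof.
move=> chi_mchar chi_nontriv.
have g'_neq0 := gsum_neq0 (is_mchar_chconj chi_mchar).
apply: (mulfI g'_neq0).
transitivity (chi (-1) * (gsum chi * gsum (chconj chi)) / q); last by ring.
by rewrite gsum_mul_chconj // mulrA mcharN1_sqr // mul1r !divff ?natr_card_neq0.
Qed.

(* For trivial [chi] the reflection formula degenerates: both Gauss sums are
   [-1]. *)
Lemma gsum_chconj_mulN chi a : is_mchar chi -> a != 0 ->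
  gsum (chconj chi) * chi (- a) =
  q / gsum chi * chi a + if nontrivial_mchar chi then 0 else N%:R.
Proof.
move=> chi_mchar a_neq0; have g_neq0 := gsum_neq0 chi_mchar.
case: ifPn => [chi_nontriv | /(trivial_mcharE chi_mchar) chi_eps].
  have -> : q = chi (-1) * (gsum chi * gsum (chconj chi)).
    by rewrite gsum_mul_chconj // mulrA mcharN1_sqr // mul1r.
  by rewrite addr0 mcharN //; field.
rewrite (eq_gsum (chconj_eps chi_eps)) (eq_gsum chi_eps) !chi_eps gsum_eps.
by rewrite /eps oppr_eq0 (negPf a_neq0) natr_pred_card; field.
Qed.

Lemma jacobi_sum_gsum chi rho : is_mchar chi -> is_mchar rho ->
  nontrivial_mchar (chmul chi rho) ->
  (\sum_x chi x * rho (1 - x)) * gsum (chmul chi rho) = gsum chi * gsum rho.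
Proof.
move=> chi_mchar rho_mchar chirho_nontriv.
have chirho_mchar := is_mchar_chmul chi_mchar rho_mchar.
have convolution s : \sum_x chi x * rho (s - x) =
    chmul chi rho s * \sum_x chi x * rho (1 - x).
  have [-> | s_neq0] := eqVneq s 0.
    under eq_bigr do rewrite sub0r mcharN // mulrCA.
    by rewrite -mulr_sumr sum_nontrivial_mchar // mchar0 // mulr0 mul0r.
  rewrite (reindex_inj (mulfI s_neq0)) mulr_sumr; apply: eq_bigr => x _ /=.
  have -> : s - s * x = s * (1 - x) by ring.
  by rewrite /chmul !mcharM //; ring.
transitivity (\sum_s psi s * \sum_x chi x * rho (s - x)).
  rewrite /gsum mulr_sumr; apply: eq_bigr => s _.
  by rewrite (convolution s); ring.
under eq_bigr do rewrite mulr_sumr.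
rewrite exchange_big /gsum mulr_suml; apply: eq_bigr => x _ /=.
rewrite (reindex_inj (addrI x)) mulr_sumr; apply: eq_bigr => y _ /=.
by rewrite [x + y]addrC addrK acharD; ring.
Qed.

End GaussSum.

(** * Power residue characters *)

Lemma count_expn_eq (K : fieldType) (d t : nat) (w y : K) (s : seq K) :
  d.-primitive_root w -> y != 0 -> uniq s ->
  (forall x, x != 0 -> (x \in s) = (x ^+ (d * t) == 1)) ->
  (y ^+ t = 1 -> exists x, x ^+ d = y) ->
  count (fun x => x ^+ d == y) s = if y ^+ t == 1 then d else 0%N.
Proof.
move=> w_prim y_neq0 s_uniq mem_s root_y.
have d_gt0 := prim_order_gt0 w_prim.
have pow_neq0 x : x ^+ d = y -> x != 0.
  move=> xd_y; apply: contraNneq y_neq0 => x0.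
  by rewrite -xd_y x0 expr0n gtn_eqF.
have pow_mem x : x ^+ d = y -> (x \in s) = (y ^+ t == 1).
  by move=> xd_y; rewrite mem_s ?pow_neq0 // exprM xd_y.
case: ifPn => [/eqP yt1 | yt_neq1]; last first.
  apply/eqP; rewrite -leqn0 leqNgt -has_count; apply/hasPn => x xs.
  by apply: contra yt_neq1 => /eqP/pow_mem <-.
have [x0 x0_y] := root_y yt1; rewrite -size_filter -[RHS]card_ord cardT.
rewrite -(size_map (fun i : 'I_d => x0 * w ^+ i)); apply: perm_size.
apply: uniq_perm; first exact: filter_uniq.
  rewrite map_inj_uniq ?enum_uniq // => i j /(mulfI (pow_neq0 _ x0_y)) /eqP.
  by rewrite (eq_prim_root_expr w_prim) !modn_small // => /eqP/val_inj.
move=> x; rewrite mem_filter; apply/andP/mapP => [[/eqP x_y _] | [i _ ->]].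
  have [|i x_i] := prim_rootP w_prim (_ : (x / x0) ^+ d = 1).
    by rewrite expr_div_n x_y x0_y divff.
  by exists i; rewrite ?mem_enum // -x_i mulrC divfK // pow_neq0.
have pow_y : (x0 * w ^+ i) ^+ d = y.
  by rewrite exprMn x0_y exprAC (prim_expr_order w_prim) expr1n mulr1.
by rewrite pow_y eqxx pow_mem // yt1.
Qed.

Section PowerResidue.
Variables (F : finFieldType) (d : nat).
Hypothesis d_dvd : (d %| #|F|.-1)%N.
Local Notation N := (#|F|.-1).
Implicit Types (rho : F -> algC) (y z : F).

Definition power_residue_mchar rho :=
  is_mchar rho /\ forall z, z != 0 -> (rho z == 1) = (z ^+ (N %/ d) == 1).

Lemma sum_power_residue_mchar rho z : power_residue_mchar rho -> z != 0 ->
  \sum_(i < d) chpow rho i z = if z ^+ (N %/ d) == 1 then d%:R else 0.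
Proof.
case=> rho_mchar rho_eq1 z_neq0; rewrite -rho_eq1 //.
under eq_bigr do rewrite chpowE //.
apply: sum_unity_root; rewrite -mcharX //; apply/eqP.
by rewrite rho_eq1 ?expf_neq0 // -exprM mulnC divnK // expf_pred_card.
Qed.

Lemma nontrivial_power_residue rho k : power_residue_mchar rho ->
  nontrivial_mchar (chpow rho k) = ~~ (d %| k)%N.
Proof.
case=> rho_mchar rho_eq1; have [g g_prim] := finField_prim_root F.
have pow_eq1 z : z != 0 -> (chpow rho k z == 1) = ((z ^+ (N %/ d)) ^+ k == 1).
  by move=> z_neq0; rewrite chpowE // -mcharX // rho_eq1 ?expf_neq0 // exprAC.
apply/existsP/idP => [[z /andP[z_neq0]] | d_ndvd].
  rewrite pow_eq1 //; apply: contra => /dvdnP[m ->].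
  rewrite mulnC exprM -[(z ^+ _) ^+ d]exprM divnK //.
  by rewrite expf_pred_card // expr1n.
have g_neq0 := prim_root_pred_card_neq0 g_prim.
exists g; rewrite g_neq0 pow_eq1 //.
by rewrite -(prim_order_dvd (dvdn_prim_root g_prim d_dvd)).
Qed.

Lemma sum_expn rho (h : F -> algC) : power_residue_mchar rho ->
  \sum_(x | x != 0) h (x ^+ d) =
  \sum_(y | y != 0) h y * \sum_(i < d) chpow rho i y.
Proof.
move=> rho_residue; pose units := [seq x <- enum F | x != 0].
have mem_units x : (x \in units) = (x != 0).
  by rewrite mem_filter mem_enum andbT.
have sum_units (k : F -> algC) : \sum_(x | x != 0) k x = \sum_(x <- units) k x.
  by rewrite big_filter big_enum_cond.
rewrite !sum_units (sum_comp_count h (s := units)) => [|| x]; last first.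
- by rewrite !mem_units; apply: expf_neq0.
- by rewrite filter_uniq ?enum_uniq.
apply: eq_big_seq => y; rewrite mem_units => y_neq0.
rewrite -mulr_natr; congr (_ * _).
have [g g_prim] := finField_prim_root F.
have w_prim := dvdn_prim_root g_prim d_dvd.
rewrite sum_power_residue_mchar //
  (@count_expn_eq _ d (N %/ d) (g ^+ (N %/ d))) //.
- by case: ifP.
- by rewrite filter_uniq ?enum_uniq.
- move=> x x_neq0.
  by rewrite mem_units x_neq0 mulnC divnK // expf_pred_card ?eqxx.
have [i ->] := prim_rootP g_prim (expf_pred_card y_neq0) => /eqP.
rewrite -exprM -(prim_order_dvd g_prim) -{1}(divnK d_dvd) mulnC.
rewrite dvdn_pmul2r ?divn_pred_card_gt0 //.
by case/dvdnP=> j ->; exists (g ^+ j); rewrite exprM.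
Qed.

End PowerResidue.

(** * Monic polynomials over a finite field *)

Section MonicPolynomials.
Variable F : finFieldType.
Implicit Types (f g h : {poly F}) (m k : nat).

Definition monics m : seq {poly F} :=
  [seq 'X^m + rVpoly v | v <- enum {: 'rV[F]_m}].

Lemma monics_uniq m : uniq (monics m).
Proof.
rewrite map_inj_uniq ?enum_uniq // => u v /addrI eq_uv.
by rewrite -(rVpolyK u) eq_uv rVpolyK.
Qed.

Lemma mem_monics m f : (f \in monics m) = (f \is monic) && (size f == m.+1).
Proof.
apply/mapP/andP => [[v _ ->] | [f_monic /eqP size_f]].
  have lt_v : (size (rVpoly v) < size ('X^m : {poly F}))%N.
    by rewrite size_polyXn ltnS size_poly.
  by rewrite monicE lead_coefDl // lead_coefXn size_polyDl // size_polyXn !eqxx.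
exists (poly_rV (f - 'X^m)); first by rewrite mem_enum.
rewrite poly_rV_K; first by rewrite addrC subrK.
apply/leq_sizeP => j; rewrite leq_eqVlt coefB coefXn => /orP[/eqP<- | lt_mj].
  by move/monicP: f_monic; rewrite /lead_coef size_f eqxx => ->; rewrite subrr.
by rewrite nth_default ?size_f // gtn_eqF // subrr.
Qed.

Lemma monics_addr m f h : f \in monics m -> (size h <= m)%N ->
  f + h \in monics m.
Proof.
rewrite !mem_monics => /andP[f_monic /eqP size_f] size_h.
have lt_hf : (size h < size f)%N by rewrite size_f.
by rewrite monicE lead_coefDl // size_polyDl // size_f -monicE f_monic eqxx.
Qed.

Lemma monics0 : perm_eq (monics 0) [:: 1].
Proof.
apply: uniq_perm; rewrite ?monics_uniq // => f; rewrite mem_monics inE.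
apply/andP/eqP => [[f_monic /eqP size_f] | ->]; last first.
  by rewrite monic1 size_poly1.
have /eqP/size_poly1P[c _ f_c] := size_f.
by move/monicP: f_monic; rewrite f_c lead_coefC => ->.
Qed.

Lemma monics1 : perm_eq (monics 1) [seq 'X - a%:P | a <- enum F].
Proof.
apply: uniq_perm; rewrite ?monics_uniq //.
  by rewrite map_inj_uniq ?enum_uniq // => a b /addrI/oppr_inj/polyC_inj.
move=> f; rewrite mem_monics.
apply/andP/mapP => [[f_monic /eqP size_f] | [a _ ->]].
  exists (- f`_0); first by rewrite mem_enum.
  apply/polyP => -[|[|i]]; rewrite coefB coefX coefC /=.
  - by rewrite sub0r opprK.
  - by rewrite subr0; move/monicP: f_monic; rewrite /lead_coef size_f.
  - by rewrite subr0 nth_default ?size_f.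
by rewrite monicXsubC size_XsubC.
Qed.

Section MonicSum.
Variables (V : nmodType) (G : {poly F} -> V).

Lemma sum_monics_addr m (P : pred {poly F}) h : (size h <= m)%N ->
  \sum_(f <- monics m | P f) G f = \sum_(f <- monics m | P (f + h)) G (f + h).
Proof.
move=> size_h; rewrite -(big_map (+%R^~ h) P G); apply: perm_big.
have shift_uniq : uniq (map (+%R^~ h) (monics m)).
  by rewrite map_inj_uniq ?monics_uniq //; apply: addIr.
have shift_sub : {subset map (+%R^~ h) (monics m) <= monics m}.
  by move=> _ /mapP[f f_m ->]; apply: monics_addr.
have [|_ shiftE] := uniq_min_size shift_uniq shift_sub.
  by rewrite !size_map.
by apply: uniq_perm; rewrite ?monics_uniq // => f; rewrite shiftE.
Qed.

Lemma sum_monics_dvdp m k g : (k <= m)%N -> g \in monics k ->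
  \sum_(f <- monics m | g %| f) G f = \sum_(h <- monics (m - k)) G (g * h).
Proof.
move=> le_km; rewrite mem_monics => /andP[g_monic /eqP size_g].
have g_neq0 := monic_neq0 g_monic.
have mem_mul h : (g * h \in monics m) = (h \in monics (m - k)).
  rewrite !mem_monics monicMl //; apply: andb_id2l => /monic_neq0 h_neq0.
  by rewrite size_monicM // size_g addSn /= -{1}(subnKC le_km) -addnS eqn_add2l.
rewrite -big_filter -(big_map ( *%R g) xpredT G); apply: perm_big.
apply: uniq_perm; rewrite ?filter_uniq ?monics_uniq //.
  by rewrite map_inj_uniq ?monics_uniq //; apply: mulfI.
move=> f; rewrite mem_filter; apply/andP/mapP => [[/dvdpP[h ->]] | [h h_m ->]].
  by rewrite mulrC mem_mul; exists h.
by rewrite dvdp_mulr // mem_mul.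
Qed.

End MonicSum.

End MonicPolynomials.

(** * Frobenius orbits *)

Lemma dvdp_prod_XsubC_count (K : fieldType) (s r : seq K) :
  (\prod_(a <- s) ('X - a%:P) %| \prod_(a <- r) ('X - a%:P)) <->
  (forall y, (count_mem y s <= count_mem y r)%N).
Proof.
split=> [s_dvd_r y | /count_subseqP[u /perm_to_subseq[v r_perm] s_perm]].
  rewrite -!mu_prod_XsubC mup_geq ?monic_neq0 ?monic_prod_XsubC //.
  apply: dvdp_trans s_dvd_r.
  by rewrite -mup_geq ?monic_neq0 ?monic_prod_XsubC.
by rewrite (perm_big _ s_perm) (perm_big _ r_perm) big_cat dvdp_mulr.
Qed.

Lemma expf_card_fixed (F : finFieldType) (K : fieldType)
    (f : {rmorphism F -> K}) (x : K) : x ^+ #|F| = x -> exists y, x = f y.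
Proof.
move=> x_fixed; have: root (map_poly f ('X^#|F| - 'X)) x.
  by rewrite rmorphB /= map_polyXn map_polyX rootE !hornerE x_fixed subrr.
rewrite finField_genPoly -big_enum /= map_prod_XsubC.
rewrite -(big_map f xpredT (fun z => 'X - z%:P)) root_prod_XsubC.
by case/mapP=> y _ ->; exists y.
Qed.

Section Frobenius.
Variables (F : finFieldType) (K : closedFieldType) (inF : {rmorphism F -> K}).
Implicit Types (f g : {poly F}) (x y : K) (rs : seq K) (d k l m : nat).

Definition frob x : K := x ^+ #|F|.

Fact pnat_pchar_card : [pchar K].-nat #|F|.
Proof.
have [p _ pcharFp] := finPcharP F; have pcharKp := rmorph_pchar inF pcharFp.
have /= := card_pprimeChar pcharFp; rewrite -/(pPrimeCharType pcharFp) => ->.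
rewrite pnatX (eq_pnat _ (pcharf_eq pcharKp)).
by rewrite pnat_id ?(pcharf_prime pcharKp).
Qed.

Fact frob_is_zmod_morphism : zmod_morphism frob.
Proof.
move=> x y; rewrite /frob exprDn_pchar ?pnat_pchar_card //.
by rewrite exprNn_pchar ?pnat_pchar_card.
Qed.

Fact frob_is_monoid_morphism : monoid_morphism frob.
Proof. by split=> [|x y]; rewrite /frob ?expr1n ?exprMn. Qed.

HB.instance Definition _ :=
  GRing.isZmodMorphism.Build K K frob frob_is_zmod_morphism.
HB.instance Definition _ :=
  GRing.isMonoidMorphism.Build K K frob frob_is_monoid_morphism.

Lemma frob_inj : injective frob.
Proof. exact: fmorph_inj. Qed.

Lemma iter_frob k x : iter k frob x = x ^+ (#|F| ^ k).
Proof. by elim: k => //= k ->; rewrite /frob -exprM expnSr. Qed.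

Lemma frob_inF (a : F) : frob (inF a) = inF a.
Proof. by rewrite /frob -rmorphXn /= expf_card. Qed.

Definition descend x : F := odflt 0 [pick a | inF a == x].

Lemma inFK : cancel inF descend.
Proof.
move=> a; rewrite /descend; case: pickP => [b /eqP/fmorph_inj // | /(_ a)].
by rewrite eqxx.
Qed.

Lemma descendK x : frob x = x -> inF (descend x) = x.
Proof. by case/(@expf_card_fixed _ _ inF) => a ->; rewrite inFK. Qed.

Lemma descend_polyK (P : {poly K}) :
  map_poly frob P = P -> map_poly inF (map_poly descend P) = P.
Proof.
move=> P_fixed; have descend0 : descend 0 = 0 by rewrite -(rmorph0 inF) inFK.
apply/polyP => i; rewrite coef_map (coef_map_id0 _ _ descend0) /= descendK //.
by rewrite -[in RHS]P_fixed coef_map.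
Qed.

Lemma map_frob_prod_XsubC rs : map_poly frob (\prod_(a <- rs) ('X - a%:P)) =
  \prod_(a <- map frob rs) ('X - a%:P).
Proof. by rewrite map_prod_XsubC big_map. Qed.

Lemma frob_sum_fixed rs d : perm_eq (map frob rs) rs ->
  frob (\sum_(r <- rs) r ^+ d) = \sum_(r <- rs) r ^+ d.
Proof.
move=> rs_fixed; rewrite rmorph_sum -[RHS](perm_big _ rs_fixed) big_map.
by apply: eq_bigr => r _; rewrite rmorphXn.
Qed.

Lemma frob_prod_fixed rs : perm_eq (map frob rs) rs ->
  frob (\prod_(r <- rs) r) = \prod_(r <- rs) r.
Proof.
by move=> rs_fixed; rewrite rmorph_prod -[RHS](perm_big _ rs_fixed) big_map.
Qed.

Lemma map_frob_traject k x :
  map frob (traject frob x k) = traject frob (frob x) k.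
Proof. by elim: k x => //= k IHk x; rewrite IHk. Qed.

Lemma perm_map_frob_traject k x : iter k frob x = x ->
  perm_eq (map frob (traject frob x k)) (traject frob x k).
Proof.
case: k => // k x_fixed; rewrite map_frob_traject trajectSr -iterSr x_fixed.
by rewrite perm_rcons.
Qed.

Definition orbit_poly k x : {poly K} :=
  \prod_(a <- traject frob x k) ('X - a%:P).

Definition orbit_charpoly k x : {poly F} := map_poly descend (orbit_poly k x).

Lemma orbit_charpolyK k x : iter k frob x = x ->
  map_poly inF (orbit_charpoly k x) = orbit_poly k x.
Proof.
move=> x_fixed; apply: descend_polyK; rewrite map_frob_prod_XsubC.
by apply: perm_big; apply: perm_map_frob_traject.
Qed.

Lemma orbit_charpoly_monics k x : iter k frob x = x ->
  orbit_charpoly k x \in monics F k.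
Proof.
move=> x_fixed; rewrite mem_monics -(map_monic inF) -(size_map_poly inF).
rewrite orbit_charpolyK // monic_prod_XsubC size_prod_XsubC.
by rewrite size_traject eqxx.
Qed.

Lemma orbit_charpoly_monic k x : iter k frob x = x ->
  orbit_charpoly k x \is monic.
Proof. by move/orbit_charpoly_monics; rewrite mem_monics => /andP[]. Qed.

Definition roots_of f : seq K :=
  sval (closed_field_poly_normal (map_poly inF f)).

Lemma roots_ofE f : f \is monic ->
  map_poly inF f = \prod_(a <- roots_of f) ('X - a%:P).
Proof.
rewrite /roots_of; case: closed_field_poly_normal => rs /= f_rs f_monic.
by rewrite f_rs (monicP _) ?map_monic // scale1r.
Qed.

Lemma size_roots_of f : f \is monic -> size (roots_of f) = (size f).-1.
Proof.
by move=> f_monic; rewrite -(size_map_poly inF) roots_ofE // size_prod_XsubC.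
Qed.

Lemma perm_roots_of f rs : f \is monic ->
  map_poly inF f = \prod_(a <- rs) ('X - a%:P) -> perm_eq (roots_of f) rs.
Proof. by move=> f_monic; rewrite roots_ofE // => /prod_XsubC_eq. Qed.

Lemma roots_ofM f g : f \is monic -> g \is monic ->
  perm_eq (roots_of (f * g)) (roots_of f ++ roots_of g).
Proof.
move=> f_monic g_monic; apply: perm_roots_of; first by rewrite monicMl.
by rewrite rmorphM /= !roots_ofE // big_cat.
Qed.

Lemma perm_roots_of_orbit k x : iter k frob x = x ->
  perm_eq (roots_of (orbit_charpoly k x)) (traject frob x k).
Proof.
move=> x_fixed; apply: perm_roots_of; first exact: orbit_charpoly_monic.
exact: orbit_charpolyK.
Qed.

Lemma perm_map_frob_roots_of f : f \is monic ->
  perm_eq (map frob (roots_of f)) (roots_of f).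
Proof.
move=> f_monic; apply: prod_XsubC_eq.
rewrite -map_frob_prod_XsubC -roots_ofE //.
by apply/polyP=> i; rewrite !coef_map /= frob_inF.
Qed.

Lemma count_roots_of_iter_frob f i x : f \is monic ->
  count_mem (iter i frob x) (roots_of f) = count_mem x (roots_of f).
Proof.
move=> f_monic; elim: i => //= i <-; set y := iter i frob x.
rewrite -(seq.permP (perm_map_frob_roots_of f_monic)) count_map.
by apply: eq_count => z /=; rewrite (inj_eq frob_inj).
Qed.

Definition fixpts k : seq K :=
  undup (sval (closed_field_poly_normal ('X^(#|F| ^ k) - 'X : {poly K}))).

Lemma fixpts_uniq k : uniq (fixpts k).
Proof. exact: undup_uniq. Qed.

(* [fixpts 0] is empty although every point is fixed by the identity. *)
Lemma mem_fixpts k x : (0 < k)%N -> (x \in fixpts k) = (iter k frob x == x).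
Proof.
move=> k_gt0; rewrite mem_undup; case: closed_field_poly_normal => rs /= rsE.
have q_gt1 : (1 < #|F| ^ k)%N.
  by rewrite -(exp1n k) ltn_exp2r // finNzRing_gt1.
have XqX_neq0 : 'X^(#|F| ^ k) - 'X != 0 :> {poly K}.
  by rewrite -size_poly_eq0 size_polyDl size_polyXn // size_polyN size_polyX.
rewrite -root_prod_XsubC -(rootZ _ _ (_ : lead_coef ('X^(#|F| ^ k) - 'X) != 0)).
  by rewrite -rsE rootE !hornerE subr_eq0 iter_frob.
by rewrite lead_coef_eq0.
Qed.

Section OrbitCount.
Variables (m : nat) (f : {poly F}).
Hypothesis f_monics : f \in monics F m.

Let f_monic : f \is monic.
Proof. by move: f_monics; rewrite mem_monics => /andP[]. Qed.

Lemma size_roots_of_monics : size (roots_of f) = m.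
Proof.
by move: f_monics; rewrite mem_monics size_roots_of // => /andP[_ /eqP ->].
Qed.

Lemma orbit_poly_dvdp l j x : (0 < l)%N -> minimal_period frob x l ->
  (orbit_poly (j * l) x %| map_poly inF f) = (j <= count_mem x (roots_of f))%N.
Proof.
move=> l_gt0 x_period.
have x_fixed : iter l frob x = x by apply/eqP; rewrite x_period.
have orbit_uniq := uniq_traject_minimal_period frob_inj x_period.
rewrite roots_ofE //; apply/idP/idP => [/dvdp_prod_XsubC_count/(_ x) | le_j].
  rewrite count_traject_mul // (count_uniq_mem _ orbit_uniq).
  case: l l_gt0 {x_period x_fixed orbit_uniq} => // l _.
  by rewrite mem_head muln1.
apply/dvdp_prod_XsubC_count => y; rewrite count_traject_mul //.
rewrite (count_uniq_mem _ orbit_uniq); case: trajectP => [[i _ ->] | _].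
  by rewrite count_roots_of_iter_frob // muln1.
by rewrite muln0.
Qed.

Lemma exists_root_minimal_period x : x \in roots_of f ->
  exists2 l, (0 < l)%N & minimal_period frob x l.
Proof.
move=> x_root; apply: (exists_minimal_period frob_inj (m := m)).
have sub_roots : {subset traject frob x m.+1 <= roots_of f}.
  move=> _ /trajectP[i _ ->]; rewrite -has_pred1 has_count.
  by rewrite count_roots_of_iter_frob // -has_count has_pred1.
apply/negP => /uniq_leq_size/(_ sub_roots).
by rewrite size_traject size_roots_of_monics ltnn.
Qed.

Lemma sum_orbit_dvdp_root x : x \in roots_of f ->
  (\sum_(1 <= k < m.+1)
     ((iter k frob x == x) && (orbit_poly k x %| map_poly inF f)%R) =
   count_mem x (roots_of f))%N.
Proof.
move=> /exists_root_minimal_period[l l_gt0 x_period].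
have dvdpE j := orbit_poly_dvdp j l_gt0 x_period.
rewrite -[RHS](@count_dvd_leq_mul l _ m) //.
  apply: eq_bigr => k _; rewrite x_period; case: dvdnP => //= -[j ->].
  by rewrite dvdpE leq_pmul2r.
set a := count_mem x (roots_of f).
have orbit_dvd : orbit_poly (a * l) x %| map_poly inF f by rewrite dvdpE.
have f_neq0 : map_poly inF f != 0 by rewrite monic_neq0 ?map_monic.
have := dvdp_leq f_neq0 orbit_dvd; rewrite roots_ofE // !size_prod_XsubC.
by rewrite size_traject size_roots_of_monics.
Qed.

Lemma count_orbit_charpoly_dvdp :
  (\sum_(1 <= k < m.+1) \sum_(x <- fixpts k) (orbit_charpoly k x %| f)%R = m)%N.
Proof.
transitivity (\sum_(1 <= k < m.+1) \sum_(x <- undup (roots_of f))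
    ((iter k frob x == x) && (orbit_poly k x %| map_poly inF f)%R))%N.
  apply: eq_big_nat => k /andP[k_gt0 _].
  rewrite -[LHS]big_mkcond -[RHS]big_mkcond /=.
  rewrite -[LHS]big_filter -[RHS]big_filter; apply: perm_big.
  apply: uniq_perm; rewrite ?filter_uniq ?undup_uniq // => x.
  rewrite !mem_filter mem_fixpts // mem_undup.
  case: eqP => [x_fixed | _]; last by rewrite andbF.
  rewrite -(dvdp_map inF) orbit_charpolyK // andbT /=.
  apply/esym/andb_idr => orbit_dvd.
  rewrite -root_prod_XsubC -roots_ofE //; apply: root_dvdp orbit_dvd _.
  by rewrite root_prod_XsubC; case: (k) k_gt0 => // ? _; rewrite mem_head.
rewrite exchange_big /=.
rewrite (eq_big_seq (fun x => count_mem x (roots_of f))) => [|x].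
  rewrite -[RHS]size_roots_of_monics.
  rewrite -(perm_size (perm_count_undup (roots_of f))) size_flatten sumnE.
  by rewrite !big_map; apply: eq_bigr => x _; rewrite size_nseq.
by rewrite mem_undup => /sum_orbit_dvdp_root.
Qed.

End OrbitCount.

Section EulerProduct.
Variables (R : comNzRingType) (L : {poly F} -> R).

Definition monic_sum m := \sum_(f <- monics F m) L f.

Definition orbit_sum k := \sum_(x <- fixpts k) L (orbit_charpoly k x).

(* The logarithmic derivative of an Euler product, with the prime powers
   counted through the points of the finite extensions. *)
Lemma monic_sum_logderiv :
  {in monic &, forall f g, L (f * g) = L f * L g} ->
  has_logderiv monic_sum orbit_sum.
Proof.
move=> LM m; transitivity (\sum_(1 <= k < m.+1) \sum_(x <- fixpts k)
    \sum_(f <- monics F m | orbit_charpoly k x %| f) L f); last first.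
  apply: eq_big_nat => k; rewrite ltnS => /andP[k_gt0 le_km]; rewrite mulr_suml.
  apply: eq_big_seq => x; rewrite mem_fixpts // => /eqP x_fixed.
  rewrite (sum_monics_dvdp L le_km (orbit_charpoly_monics x_fixed)) mulr_sumr.
  apply: eq_big_seq => h; rewrite mem_monics => /andP[h_monic _].
  by rewrite LM ?orbit_charpoly_monic.
under [RHS]eq_bigr do rewrite (exchange_big_dep xpredT) //=.
rewrite exchange_big /= -sumrMnl; apply: eq_big_seq => f f_m.
rewrite -{1}(count_orbit_charpoly_dvdp f_m) -sumrMnr; apply: eq_bigr => k _.
rewrite -sumrMnr [RHS]big_mkcond; apply: eq_bigr => x _.
by case: (_ %| _).
Qed.

End EulerProduct.

Definition power_sum d f : F := descend (\sum_(r <- roots_of f) r ^+ d).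

Lemma power_sumE d f : f \is monic ->
  inF (power_sum d f) = \sum_(r <- roots_of f) r ^+ d.
Proof.
by move=> f_monic; rewrite descendK // frob_sum_fixed ?perm_map_frob_roots_of.
Qed.

Lemma power_sumM d : {in monic &, forall f g,
  power_sum d (f * g) = power_sum d f + power_sum d g}.
Proof.
move=> f g f_monic g_monic; apply: (fmorph_inj inF).
rewrite rmorphD /= !power_sumE // ?monicMl //.
by rewrite (perm_big _ (roots_ofM f_monic g_monic)) big_cat.
Qed.

Lemma power_sum_monic1 d : power_sum d 1 = 0.
Proof.
have := power_sumM d (monic1 F) (monic1 F).
by rewrite mulr1 -[LHS]addr0 => /addrI.
Qed.

Lemma power_sum1 f : f \is monic -> (1 < size f)%N ->
  power_sum 1 f = - f`_(size f).-2.
Proof.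
move=> f_monic size_f; apply: (fmorph_inj inF).
rewrite power_sumE // rmorphN /=.
rewrite -coef_map roots_ofE // -size_roots_of // coefPn_prod_XsubC ?opprK //.
by rewrite size_roots_of //; case: (size f) size_f => [|[]].
Qed.

Lemma power_sum_monics_addC d f c : (0 < d)%N -> f \in monics F d ->
  power_sum d (f + c%:P) = power_sum d f - c *+ d.
Proof.
move=> d_gt0 f_d; have fc_d : f + c%:P \in monics F d.
  by rewrite monics_addr // (leq_trans (size_polyC_leq1 c)).
have monic_d g : g \in monics F d -> g \is monic.
  by rewrite mem_monics => /andP[].
apply: (fmorph_inj inF); rewrite rmorphB rmorphMn /= !power_sumE ?monic_d //.
apply: power_sum_addC (size_roots_of_monics f_d) (size_roots_of_monics fc_d)
  d_gt0 _.
by rewrite -!roots_ofE ?monic_d // rmorphD /= map_polyC.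
Qed.

Definition root_prod f : F := (-1) ^+ (size f).-1 * f`_0.

Lemma root_prodE f : f \is monic ->
  inF (root_prod f) = \prod_(r <- roots_of f) r.
Proof.
move=> f_monic; rewrite rmorphM rmorphXn rmorphN1 /= -coef_map roots_ofE //.
by rewrite coef0_prod_XsubC size_roots_of // signrMK.
Qed.

Lemma root_prodM :
  {in monic &, forall f g, root_prod (f * g) = root_prod f * root_prod g}.
Proof.
move=> f g f_monic g_monic; apply: (fmorph_inj inF).
rewrite [RHS]rmorphM /= !root_prodE // ?monicMl //.
by rewrite (perm_big _ (roots_ofM f_monic g_monic)) big_cat.
Qed.

Definition ext_norm k x : F := descend (\prod_(a <- traject frob x k) a).

Definition ext_trace k x : F := descend (\sum_(a <- traject frob x k) a).

Section FixedPoint.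
Variables (k : nat) (x : K).
Hypothesis x_fixed : iter k frob x = x.

Lemma iter_frobX d : iter k frob (x ^+ d) = x ^+ d.
Proof. by rewrite iter_frob exprAC -iter_frob x_fixed. Qed.

Lemma ext_normE : inF (ext_norm k x) = x ^+ (\sum_(i < k) #|F| ^ i).
Proof.
rewrite descendK ?frob_prod_fixed ?perm_map_frob_traject //.
elim: k => [|j IHj]; first by rewrite big_nil big_ord0.
by rewrite trajectSr big_rcons IHj big_ord_recr exprD iter_frob.
Qed.

Lemma ext_norm_eq0 : (0 < k)%N -> (ext_norm k x == 0) = (x == 0).
Proof.
case: k ext_normE => // j normE _.
by rewrite -(fmorph_eq0 inF) normE expf_eq0 big_ord_recl expn0.
Qed.

Lemma root_prod_orbit_charpoly : root_prod (orbit_charpoly k x) = ext_norm k x.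
Proof.
rewrite -[LHS]inFK root_prodE ?orbit_charpoly_monic //.
by rewrite (perm_big _ (perm_roots_of_orbit x_fixed)).
Qed.

Lemma power_sum_orbit_charpoly d :
  power_sum d (orbit_charpoly k x) = ext_trace k (x ^+ d).
Proof.
rewrite /power_sum (perm_big _ (perm_roots_of_orbit x_fixed)); congr descend.
elim: k (x) => [|j IHj] y; first by rewrite !big_nil.
by rewrite /= !big_cons IHj rmorphXn.
Qed.

End FixedPoint.

Lemma ext_normX k x d : iter k frob x = x ->
  ext_norm k (x ^+ d) = ext_norm k x ^+ d.
Proof.
move=> x_fixed; apply: (fmorph_inj inF).
by rewrite rmorphXn /= !ext_normE ?iter_frobX // exprAC.
Qed.

(** * The Hasse-Davenport product formula *)

Section LSeries.
Variable psi : F -> algC.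
Hypothesis psi_achar : nontrivial_achar psi.
Implicit Types (chi rho : F -> algC).

Definition poly_char chi d f : algC := chi (root_prod f) * psi (power_sum d f).

Lemma poly_charM chi d : is_mchar chi ->
  {in monic &, {morph poly_char chi d : f g / f * g}}.
Proof.
move=> chi_mchar f g f_monic g_monic.
by rewrite /poly_char root_prodM // power_sumM // mcharM // acharD // mulrACA.
Qed.

Lemma monic_sum_poly_char0 chi d :
  is_mchar chi -> monic_sum (poly_char chi d) 0 = 1.
Proof.
move=> chi_mchar; rewrite /monic_sum (perm_big _ (monics0 F)) big_seq1.
rewrite /poly_char power_sum_monic1 achar0 //.
rewrite /root_prod size_poly1 coef1 !mulr1.
exact: mchar1.
Qed.

Lemma monic_sum_poly_char1 chi : monic_sum (poly_char chi 1) 1 = gsum psi chi.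
Proof.
rewrite /monic_sum (perm_big _ (monics1 F)) big_map big_enum.
apply: eq_bigr => a _; rewrite /poly_char power_sum1 ?monicXsubC ?size_XsubC //.
by rewrite /root_prod size_XsubC coefB coefX coefC /= sub0r mulrNN mul1r opprK.
Qed.

(* Adding a multiple of [X ^ m.-1] does not change the product of the roots but
   shifts their sum. *)
Lemma monic_sum_poly_char_gt1 chi m :
  (1 < m)%N -> monic_sum (poly_char chi 1) m = 0.
Proof.
move=> m_gt1; have [_ _ [c psi_c]] := psi_achar.
apply: (fixed_mulr_eq0 psi_c); pose h : {poly F} := (- c) *: 'X^(m.-1).
have size_h : (size h <= m)%N.
  by rewrite (leq_trans (size_scale_leq _ _)) // size_polyXn prednK // ltnW.
rewrite [LHS](sum_monics_addr _ _ size_h) mulr_sumr.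
apply: eq_big_seq => f f_m; move: (f_m) (monics_addr f_m size_h).
rewrite !mem_monics => /andP[f_monic /eqP size_f] /andP[fh_monic /eqP size_fh].
rewrite /poly_char /root_prod.
rewrite !power_sum1 ?size_f ?size_fh ?ltnS ?(ltnW m_gt1) //=.
rewrite !coefD !coefZ !coefXn eqxx.
have -> : (0 == m.-1)%N = false by case: (m) m_gt1 => [|[]].
by rewrite mulr0 addr0 mulr1 opprD opprK acharD //; ring.
Qed.

Lemma has_logderiv_recip_gsum d (chi : 'I_d -> F -> algC) :
  (forall i, is_mchar (chi i)) ->
  has_logderiv (nth 0 (recip_prod [seq - gsum psi (chi i) | i : 'I_d]))
    (fun k => \sum_(i < d) orbit_sum (poly_char (chi i) 1) k).
Proof.
move=> chi_mchar; rewrite /recip_prod big_map big_enum.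
apply: has_logderiv_prod => i m.
have coefE j : (1 - - gsum psi (chi i) *: 'X : {poly algC})`_j =
    monic_sum (poly_char (chi i) 1) j.
  rewrite coefB coef1 coefZ coefX; case: j => [|[|j]].
  - by rewrite monic_sum_poly_char0 // mulr0 subr0.
  - by rewrite monic_sum_poly_char1 mulr1 sub0r opprK.
  - by rewrite monic_sum_poly_char_gt1 // mulr0 subr0.
rewrite coefE (monic_sum_logderiv (poly_charM 1 (chi_mchar i))).
by apply: eq_bigr => k _; rewrite coefE.
Qed.

Definition hasse_davenport_const d : algC :=
  \sum_(f <- monics F d | f`_0 == 0) psi (power_sum d f).

Lemma monic_sum_poly_char_deg chi d : (0 < d)%N ->
  monic_sum (poly_char chi d) d = hasse_davenport_const d *
    \sum_c chi ((-1) ^+ d * c) * psi (- (c *+ d)).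
Proof.
move=> d_gt0.
rewrite /monic_sum (partition_big (fun f : {poly F} => f`_0) xpredT) //=.
rewrite mulr_sumr; apply: eq_bigr => c _.
have size_c := leq_trans (size_polyC_leq1 c) d_gt0.
rewrite (sum_monics_addr _ _ size_c) mulr_suml.
rewrite (eq_bigl (fun f : {poly F} => f`_0 == 0)) => [|f]; last first.
  by rewrite coefD coefC /= -subr_eq0 addrK.
rewrite [LHS]big_seq_cond [RHS]big_seq_cond.
apply: eq_bigr => f /andP[f_d /eqP f0].
rewrite /poly_char power_sum_monics_addC // acharD //.
rewrite /root_prod coefD f0 coefC add0r.
have := monics_addr f_d size_c; rewrite mem_monics => /andP[_ /eqP ->] /=.
by ring.
Qed.

Section ProductFormula.
Variables (d : nat) (rho : F -> algC).
Hypotheses (d_dvd : (d %| #|F|.-1)%N) (rho_residue : power_residue_mchar d rho).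

Let d_gt0 : (0 < d)%N := dvdn_pred_card_gt0 d_dvd.
Let rho_mchar : is_mchar rho := proj1 rho_residue.

Lemma fixpts_unity k x : (0 < k)%N -> x != 0 ->
  (x \in fixpts k) = (x ^+ (#|F| ^ k).-1 == 1).
Proof.
move=> k_gt0 x_neq0; rewrite mem_fixpts // iter_frob.
rewrite -[X in x ^+ X]prednK ?expn_gt0 ?finField_card_gt0 //.
by rewrite exprS -{3}[x]mulr1 (inj_eq (mulfI x_neq0)).
Qed.

Lemma count_fixpts_expn k y : (0 < k)%N -> y \in fixpts k -> y != 0 ->
  (count (fun x => x ^+ d == y) (fixpts k))%:R =
  \sum_(i < d) chpow rho i (ext_norm k y).
Proof.
move=> k_gt0 y_fix y_neq0; have y_fixed : iter k frob y = y.
  by apply/eqP; rewrite -mem_fixpts.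
have [g g_prim] := finField_prim_root F.
have w_prim := dvdn_prim_root g_prim d_dvd.
rewrite (sum_power_residue_mchar d_dvd rho_residue) ?ext_norm_eq0 //.
pose t := (#|F|.-1 %/ d * \sum_(i < k) #|F| ^ i)%N.
have dt : (d * t = (#|F| ^ k).-1)%N.
  by rewrite mulnA [(d * _)%N]mulnC divnK // -predn_exp.
have norm_yt : (ext_norm k y ^+ (#|F|.-1 %/ d) == 1) = (y ^+ t == 1).
  rewrite -(inj_eq (fmorph_inj inF)) rmorphXn rmorph1 /= ext_normE //.
  by rewrite -exprM mulnC.
pose w := inF (g ^+ (#|F|.-1 %/ d)).
rewrite norm_yt (@count_expn_eq _ d t w) ?fixpts_uniq //.
- by case: ifP.
- by rewrite fmorph_primitive_root.
- by move=> x x_neq0; rewrite fixpts_unity // dt.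
have [x /eqP] : exists x : K, root ('X^d - y%:P) x.
  by apply/closed_rootP; rewrite size_XnsubC // eqSS gtn_eqF.
by rewrite !hornerE => /subr0_eq x_y _; exists x.
Qed.

Lemma sum_orbit_sum chi k : is_mchar chi -> (0 < k)%N ->
  \sum_(i < d) orbit_sum (poly_char (chmul (chpow rho i) chi) 1) k =
  orbit_sum (poly_char (chpow chi d) d) k.
Proof.
move=> chi_mchar k_gt0; pose h y := chi (ext_norm k y) * psi (ext_trace k y).
have fixedP x : x \in fixpts k -> iter k frob x = x.
  by rewrite mem_fixpts // => /eqP.
transitivity (\sum_(y <- fixpts k)
    h y * \sum_(i < d) chpow rho i (ext_norm k y)).
  rewrite exchange_big; apply: eq_big_seq => y /fixedP y_fixed /=.
  rewrite mulr_sumr; apply: eq_bigr => i _; rewrite /poly_char /chmul /h.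
  rewrite root_prod_orbit_charpoly // power_sum_orbit_charpoly // expr1.
  by rewrite -mulrA mulrC.
transitivity (\sum_(x <- fixpts k) h (x ^+ d)).
  rewrite (sum_comp_count h (fixpts_uniq k)); last first.
    by move=> x /fixedP x_fixed; rewrite mem_fixpts // iter_frobX.
  apply: eq_big_seq => y y_fix.
  have [norm0 | norm_neq0] := eqVneq (ext_norm k y) 0.
    by rewrite /h norm0 mchar0 // !mul0r mul0rn.
  by rewrite -count_fixpts_expn ?mulr_natr // -(ext_norm_eq0 (fixedP _ y_fix)).
apply: eq_big_seq => x /fixedP x_fixed; rewrite /h /poly_char.
rewrite root_prod_orbit_charpoly // power_sum_orbit_charpoly // ext_normX //.
by rewrite mcharX // chpowE_gt0.
Qed.

(* Both sides are the coefficient of degree [d] of the same L-series, which is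
   a product of [d] linear factors. *)
Lemma prod_gsum_monic_sum chi : is_mchar chi ->
  \prod_(i < d) gsum psi (chmul (chpow rho i) chi) =
  monic_sum (poly_char (chpow chi d) d) d.
Proof.
move=> chi_mchar; have chid_mchar := is_mchar_chpow d chi_mchar.
have chi_i_mchar (i : 'I_d) : is_mchar (chmul (chpow rho i) chi).
  by apply: is_mchar_chmul => //; apply: is_mchar_chpow.
pose rs := [seq - gsum psi (chmul (chpow rho i) chi) | i : 'I_d].
have size_rs : size rs = d by rewrite size_map -cardE card_ord.
transitivity (recip_prod rs)`_d.
  rewrite coef_recip_prod size_rs leqnn subnn coef0_prod_XsubC size_rs.
  by rewrite big_map big_enum prodrN card_ord signrMK.
apply: (has_logderiv_unique (has_logderiv_recip_gsum chi_i_mchar)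
  (monic_sum_logderiv (poly_charM d chid_mchar))) => [|k k_gt0].
  by rewrite coef0_recip_prod monic_sum_poly_char0.
exact: sum_orbit_sum.
Qed.

End ProductFormula.

End LSeries.

End Frobenius.

Section HasseDavenport.
Variables (F : finFieldType) (psi : F -> algC) (d : nat) (rho : F -> algC).
Hypotheses (psi_achar : nontrivial_achar psi) (d_dvd : (d %| #|F|.-1)%N).
Hypothesis rho_residue : power_residue_mchar d rho.
Implicit Types chi : F -> algC.

Let d_gt0 : (0 < d)%N := dvdn_pred_card_gt0 d_dvd.

Lemma sum_chpow_const_coef chi : is_mchar chi ->
  \sum_c chpow chi d ((-1) ^+ d * c) * psi (- (c *+ d)) =
  (chpow chi d d%:R)^-1 * gsum psi (chpow chi d).
Proof.
move=> chi_mchar; have chid_mchar := is_mchar_chpow d chi_mchar.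
have d_neq0 : d%:R != 0 :> F := natr_dvd_pred_card_neq0 d_dvd.
have chidN1 : chpow chi d ((-1) ^+ d) = chpow chi d (-1).
  rewrite !chpowE_gt0 // -!mcharX // -exprM; congr (chi _).
  by rewrite -signr_odd oddM andbb signr_odd.
transitivity (chpow chi d ((-1) ^+ d) *
    \sum_c chpow chi d c * psi (- d%:R * c)).
  rewrite mulr_sumr; apply: eq_bigr => c _.
  by rewrite mcharM // mulrA mulNr mulr_natl.
rewrite gsum_scale ?oppr_eq0 // chidN1 (mcharN chid_mchar d%:R) invfM !mulrA.
by rewrite divff ?mul1r ?mcharN1_neq0.
Qed.

Theorem hasse_davenport_product chi : is_mchar chi ->
  \prod_(i < d) gsum psi (chmul (chpow rho i) chi) =
  (chpow chi d d%:R)^-1 * gsum psi (chpow chi d) *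
    \prod_(1 <= i < d) gsum psi (chpow rho i).
Proof.
have [K [inF _]] := countable_algebraic_closure F.
have prodE chi' : is_mchar chi' ->
    \prod_(i < d) gsum psi (chmul (chpow rho i) chi') =
    hasse_davenport_const inF psi d *
      ((chpow chi' d d%:R)^-1 * gsum psi (chpow chi' d)).
  move=> chi'_mchar; rewrite -sum_chpow_const_coef //.
  rewrite -monic_sum_poly_char_deg //.
  exact: prod_gsum_monic_sum.
have rho0 : chpow rho 0 =1 @eps F by move=> x; rewrite /chpow /eps expr0.
have prod_eps : \prod_(i < d) gsum psi (chmul (chpow rho i) (@eps F)) =
    - \prod_(1 <= i < d) gsum psi (chpow rho i).
  under [LHS]eq_bigr => i _ do
    rewrite (eq_gsum psi (chmul_eps (is_mchar_chpow i (proj1 rho_residue)))).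
  rewrite -(big_mkord xpredT (fun i => gsum psi (chpow rho i))) big_ltn //.
  by rewrite (eq_gsum _ rho0) gsum_eps // mulN1r.
have -> : \prod_(1 <= i < d) gsum psi (chpow rho i) =
    hasse_davenport_const inF psi d.
  have eps_d : @eps F d%:R = 1.
    by rewrite /eps (negPf (natr_dvd_pred_card_neq0 d_dvd)).
  apply: oppr_inj; rewrite -prod_eps prodE; last exact: is_mchar_eps.
  rewrite chpow_eps // eps_d invr1 mul1r.
  by rewrite (eq_gsum _ (chpow_eps _ _)) // gsum_eps // mulrN1.
by move=> chi_mchar; rewrite prodE // mulrC.
Qed.

End HasseDavenport.

(** * Powers of a generator of the character group *)

Section Generator.
Variables (F : finFieldType) (T : F -> algC).
Hypothesis T_gen : is_char_generator T.
Local Notation N := (#|F|.-1).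
Implicit Types (x y g : F) (k l : nat).

Let T_mchar : is_mchar T := proj1 T_gen.

Lemma generator_prim_root g : N.-primitive_root g -> N.-primitive_root (T g).
Proof.
move=> g_prim; have g_neq0 := prim_root_pred_card_neq0 g_prim.
have [m Tg_prim m_dvd] :=
  prim_order_exists (finField_pred_card_gt0 F) (mchar_unity T_mchar g_neq0).
suff dvd_m : (N %| m)%N by have /eqP<- : m == N by rewrite eqn_dvd m_dvd dvd_m.
apply: (proj2 T_gen) => x x_neq0.
have [i ->] := prim_rootP g_prim (expf_pred_card x_neq0).
by rewrite mcharX // exprAC (prim_expr_order Tg_prim) expr1n.
Qed.

Lemma generator_eq1 x : x != 0 -> (T x == 1) = (x == 1).
Proof.
move=> x_neq0; have [g g_prim] := finField_prim_root F.
have [i ->] := prim_rootP g_prim (expf_pred_card x_neq0); rewrite mcharX //.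
by rewrite -(prim_order_dvd (generator_prim_root g_prim))
  (prim_order_dvd g_prim).
Qed.

Lemma mchar_generator_pow chi : is_mchar chi -> {j : 'I_N | chi =1 chpow T j}.
Proof.
move=> chi_mchar; have [g g_prim] := finField_prim_root F.
have g_neq0 := prim_root_pred_card_neq0 g_prim.
have [j chi_g] := prim_rootP (generator_prim_root g_prim)
  (mchar_unity chi_mchar g_neq0).
exists j => x.
have [-> | x_neq0] := eqVneq x 0; first by rewrite chpow_at0 mchar0.
have [i ->] := prim_rootP g_prim (expf_pred_card x_neq0).
by rewrite chpowE ?expf_neq0 // !mcharX // chi_g exprAC.
Qed.

Lemma chpow_dvd k : (N %| k)%N -> chpow T k =1 @eps F.
Proof.
move=> /dvdnP[m ->] x; rewrite /chpow /eps; case: eqVneq => // x_neq0.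
by rewrite mulnC exprM mchar_unity // expr1n.
Qed.

Lemma periodic_chpow x : periodic N (chpow T ^~ x).
Proof.
have chpow_mod m : chpow T m x = chpow T (m %% N) x.
  rewrite {1}(divn_eq m N) chpowD /chmul chpow_dvd ?dvdn_mull // /eps /chpow.
  by case: eqP; rewrite ?mul0r ?mul1r.
by move=> k l eq_kl; rewrite chpow_mod eq_kl -chpow_mod.
Qed.

Lemma nontrivial_chpow k : nontrivial_mchar (chpow T k) = ~~ (N %| k)%N.
Proof.
apply: nontrivial_power_residue => //; split=> // z z_neq0.
by rewrite generator_eq1 // divnn finField_pred_card_gt0 expr1.
Qed.

Lemma sum_chpow k :
  \sum_(x | x != 0) chpow T k x = if (N %| k)%N then N%:R else 0.
Proof.
have <- : \sum_x chpow T k x = \sum_(x | x != 0) chpow T k x.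
  by rewrite (bigD1 0) //= chpow_at0 add0r.
case: ifPn => [dvd_k | ndvd].
  by rewrite -sum_eps; apply: eq_bigr => x _; apply: chpow_dvd.
by rewrite sum_nontrivial_mchar ?nontrivial_chpow //; apply: is_mchar_chpow.
Qed.

Lemma sum_powers_generator x :
  \sum_(k < N) chpow T k x = if x == 1 then N%:R else 0.
Proof.
have [-> | x_neq0] := eqVneq x 0.
  by rewrite eq_sym oner_eq0 big1 // => k _; apply: chpow_at0.
rewrite -generator_eq1 // -sum_unity_root ?mchar_unity //.
by apply: eq_bigr => k _; rewrite chpowE.
Qed.

Lemma generator_power_residue d : (d %| N)%N ->
  power_residue_mchar d (chpow T (N %/ d)).
Proof.
move=> d_dvd; split=> [|z z_neq0]; first exact: is_mchar_chpow.
by rewrite chpowE // -mcharX // generator_eq1 ?expf_neq0.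
Qed.

Lemma char_of_unit (i : Iirr (unitsG F)) (u : {unit F}) :
  char_of i (val u) = 'chi[unitsG F]_i u.
Proof. by rewrite /char_of valK. Qed.

Lemma is_mchar_char_of (i : Iirr (unitsG F)) : is_mchar (char_of i).
Proof.
have abelianG : abelian (unitsG F).
  exact: cyclic_abelian (field_unit_group_cyclic _).
have chi_lin : 'chi_i \is a linear_char by apply/char_abelianP.
have char_of0 : char_of i 0 = 0 by rewrite /char_of insubF // unitr0.
split=> //; split=> [|x y].
  by rewrite (char_of_unit i 1%g) lin_char1.
have [-> | x_neq0] := eqVneq x 0; first by rewrite mul0r char_of0 mul0r.
have [-> | y_neq0] := eqVneq y 0; first by rewrite mulr0 char_of0 mulr0.
rewrite -unitfE in x_neq0; rewrite -unitfE in y_neq0.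
pose u := FinRing.unit F x_neq0; pose v := FinRing.unit F y_neq0.
by rewrite (char_of_unit i (u * v)%g) lin_charM ?in_setT // -!char_of_unit.
Qed.

Lemma char_of_inj (i j : Iirr (unitsG F)) : char_of i =1 char_of j -> i = j.
Proof.
by move=> eq_ij; apply/irr_inj/cfun_inP => u _; rewrite -!char_of_unit eq_ij.
Qed.

Section SumOverCharacters.
Variable h : (F -> algC) -> algC.
Hypothesis eq_h : forall chi rho, chi =1 rho -> h chi = h rho.

Lemma sum_char_of :
  \sum_(i : Iirr (unitsG F)) h (char_of i) = \sum_(j < N) h (chpow T j).
Proof.
pose j_ i := sval (mchar_generator_pow (is_mchar_char_of i)).
have char_j i : char_of i =1 chpow T (j_ i) := svalP (mchar_generator_pow _).
have j_inj : injective j_.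
  by move=> i i' eq_j; apply: char_of_inj => x; rewrite !char_j eq_j.
have abelianG : abelian (unitsG F).
  exact: cyclic_abelian (field_unit_group_cyclic _).
rewrite [RHS](reindex j_) /=; first by apply: eq_bigr => i _; apply/eq_h/char_j.
apply/onW_bij/inj_card_bij => //.
by rewrite card_ord card_Iirr_abelian // card_finField_unit.
Qed.

Lemma sum_char_of_chconj :
  \sum_(i : Iirr (unitsG F)) h (char_of i) =
  \sum_(i : Iirr (unitsG F)) h (chconj (char_of i)).
Proof.
rewrite (reindex_inj (can_inj (@conjC_IirrK _ _))); apply: eq_bigr => i _.
apply: eq_h => x; rewrite /chconj /char_of.
case: insub => [u|]; last by rewrite conjC0.
by rewrite conjC_IirrE cfunE.
Qed.

End SumOverCharacters.

Section GaussSumPowers.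
Variable psi : F -> algC.
Local Notation G k := (gsum psi (chpow T k)).
Local Notation Gconj k := (gsum psi (chconj (chpow T k))).

Lemma periodic_gsum_chpow : periodic N (fun k => G k).
Proof. by move=> k l eq_kl; apply: eq_gsum => x; apply: periodic_chpow. Qed.

Lemma periodic_gsum_chconj : periodic N (fun k => Gconj k).
Proof.
move=> k l eq_kl; apply: eq_gsum => x.
by rewrite /chconj (periodic_chpow x eq_kl).
Qed.

Lemma achar_fourier y : y != 0 ->
  N%:R * psi y = \sum_(k < N) Gconj k * chpow T k y.
Proof.
move=> y_neq0.
have Tk_mchar k : is_mchar (chpow T k) := is_mchar_chpow k T_mchar.
have div_eq1 x : (y / x == 1) = (x == y).
  have [-> | x_neq0] := eqVneq x 0.
    by rewrite invr0 mulr0 !(eq_sym 0) oner_eq0 (negPf y_neq0).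
  by rewrite -(inj_eq (mulIf x_neq0)) divfK // mul1r eq_sym.
transitivity (\sum_x psi x * \sum_(k < N) chpow T k (y / x)).
  rewrite (bigD1 y) //= sum_powers_generator div_eq1 eqxx mulrC big1 ?addr0 //.
  move=> x /negPf x_neq_y.
  by rewrite sum_powers_generator div_eq1 x_neq_y mulr0.
under eq_bigr do rewrite mulr_sumr.
rewrite exchange_big; apply: eq_bigr => k _ /=.
rewrite mulr_suml; apply: eq_bigr => x _.
by rewrite mcharM // mcharV // chconjE //; ring.
Qed.

End GaussSumPowers.

End Generator.

(** * Greene's hypergeometric function *)

Lemma eq_jbinom (F : finFieldType) (A A' B B' : F -> algC) :
  A =1 A' -> B =1 B' -> jbinom A B = jbinom A' B'.
Proof.
move=> eqA eqB; rewrite /jbinom eqB; congr (_ * _).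
by apply: eq_bigr => x _; rewrite eqA eqB.
Qed.

Definition greene_summand (F : finFieldType) n (A : 'I_n.+1 -> F -> algC)
    (x : F) (chi : F -> algC) : algC :=
  (\prod_(k < n.+1) jbinom (chmul (A k) chi) chi) * chi x.

Lemma eq_greene_summand (F : finFieldType) n (A : 'I_n.+1 -> F -> algC)
    (x : F) chi rho :
  chi =1 rho -> greene_summand A x chi = greene_summand A x rho.
Proof.
move=> eq_chi; rewrite /greene_summand eq_chi; congr (_ * _).
by apply: eq_bigr => k _; apply: eq_jbinom => // y; rewrite /chmul eq_chi.
Qed.

Lemma greeneF_eps (F : finFieldType) n (A : 'I_n.+1 -> F -> algC) (x : F) :
  greeneF A (fun=> @eps F) x = #|F|%:R / (#|F|%:R - 1) *
    \sum_(i : Iirr (unitsG F)) greene_summand A x (char_of i).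
Proof.
rewrite /greeneF; congr (_ * _); apply: eq_bigr => i _; congr (_ * _).
rewrite big_ord_recl; congr (_ * _); apply: eq_bigr => k _.
apply: eq_jbinom => // y.
rewrite /chmul /eps; case: eqP => [-> | _]; last by rewrite mul1r.
by rewrite mul0r mchar0 //; apply: is_mchar_char_of.
Qed.

Section Greene.
Variables (F : finFieldType) (psi : F -> algC).
Hypothesis psi_achar : nontrivial_achar psi.
Local Notation N := (#|F|.-1).
Local Notation q := (#|F|%:R : algC).
Local Notation gsum := (gsum psi).
Implicit Types (chi A rho : F -> algC).

Lemma jbinom_gsum A chi : is_mchar A -> nontrivial_mchar A -> is_mchar chi ->
  jbinom (chmul A (chconj chi)) (chconj chi) =
  chi (-1) / q * (gsum (chmul A (chconj chi)) * gsum chi / gsum A).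
Proof.
move=> A_mchar A_nontriv chi_mchar.
have chi'_mchar := is_mchar_chconj chi_mchar.
have A_prod : chmul (chmul A (chconj chi)) chi =1 A.
  move=> x; rewrite /chmul chconjE //; have [-> | x_neq0] := eqVneq x 0.
    by rewrite !mchar0 // mulr0.
  by rewrite mulfVK ?mchar_neq0.
rewrite /jbinom chconjE // mcharN1_inv //; congr (_ * _).
rewrite -jacobi_sum_gsum ?(eq_nontrivial_mchar A_prod) //; last first.
  exact: is_mchar_chmul.
rewrite (eq_gsum _ A_prod) mulfK ?gsum_neq0 //; apply: eq_bigr => x _.
by rewrite [chconj chi (1 - x)]/chconj conjCK.
Qed.

Section ProductOfBinomials.
Variables (d : nat) (rho : F -> algC).
Hypotheses (d_dvd : (d %| N)%N) (rho_residue : power_residue_mchar d rho).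

Let d_gt0 : (0 < d)%N := dvdn_pred_card_gt0 d_dvd.

Lemma prod_gsum_chconj chi : is_mchar chi ->
  \prod_(1 <= i < d) gsum (chmul (chpow rho i) (chconj chi)) =
  chpow chi d d%:R * gsum (chconj (chpow chi d)) / gsum (chconj chi) *
    \prod_(1 <= i < d) gsum (chpow rho i).
Proof.
move=> chi_mchar; have chi'_mchar := is_mchar_chconj chi_mchar.
have := hasse_davenport_product psi_achar d_dvd rho_residue chi'_mchar.
rewrite chpow_chconj (eq_gsum _ (chpow_chconj chi d)).
rewrite -(big_mkord xpredT (fun i => gsum (chmul (chpow rho i) (chconj chi)))).
rewrite big_ltn //.
have rho0_chi : chmul (chpow rho 0) (chconj chi) =1 chconj chi.
  move=> x; rewrite /chmul /chpow.
  by case: eqP => [->|_]; rewrite ?mul1r // mchar0 ?mul0r.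
rewrite (eq_gsum _ rho0_chi) chconjE ?invrK; last exact: is_mchar_chpow.
move=> product; apply: (mulfI (gsum_neq0 psi_achar chi'_mchar)).
by rewrite product; field; apply: gsum_neq0.
Qed.

Lemma prod_jbinom chi : is_mchar chi ->
  q ^+ d.-1 * \prod_(1 <= i < d)
    jbinom (chmul (chpow rho i) (chconj chi)) (chconj chi) =
  (chi (-1) * gsum chi) ^+ d.-1 *
    (chpow chi d d%:R * gsum (chconj (chpow chi d)) / gsum (chconj chi)).
Proof.
move=> chi_mchar.
have binomE i : (1 <= i < d)%N ->
    jbinom (chmul (chpow rho i) (chconj chi)) (chconj chi) =
    chi (-1) * gsum chi / q *
      (gsum (chmul (chpow rho i) (chconj chi)) / gsum (chpow rho i)).
  case/andP=> i_gt0 lt_id.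
  have rhoi_mchar := is_mchar_chpow i (proj1 rho_residue).
  by rewrite jbinom_gsum ?(nontrivial_power_residue d_dvd) ?gtnNdvd //; ring.
rewrite (eq_big_nat _ _ binomE) big_split prodr_const_nat subn1.
rewrite big_split prodfV /=.
have prod_neq0 : \prod_(1 <= i < d) gsum (chpow rho i) != 0.
  rewrite prodf_seq_neq0; apply/allP => i _; apply: gsum_neq0 => //.
  exact: is_mchar_chpow (proj1 rho_residue).
rewrite prod_gsum_chconj // mulfK // [LHS]mulrA -exprMn; congr (_ ^+ _ * _).
by rewrite mulrC divfK ?natr_card_neq0.
Qed.

(* The exceptional term comes from the nontrivial [chi] with [chi ^ d] trivial,
   for which the reflection formula of [chpow chi d] degenerates. *)
Lemma greene_term chi lam : is_mchar chi -> lam != 0 ->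
  q ^+ d.-1 * ((\prod_(1 <= i < d)
      jbinom (chmul (chpow rho i) (chconj chi)) (chconj chi)) *
    chconj chi (lam ^- d)) =
  gsum chi ^+ d / gsum (chpow chi d) * chpow chi d (d%:R * lam) +
  if nontrivial_mchar chi && ~~ nontrivial_mchar (chpow chi d)
  then N%:R / q * gsum chi ^+ d else 0.
Proof.
move=> chi_mchar lam_neq0; have chid_mchar := is_mchar_chpow d chi_mchar.
have q_neq0 := natr_card_neq0 F.
have -> : chconj chi (lam ^- d) = chpow chi d lam.
  by rewrite chconjE // mcharV // invrK chpowE_gt0 // mcharX.
have expnd (u : algC) : u ^+ d = u ^+ d.-1 * u by rewrite -exprSr prednK.
rewrite mulrA prod_jbinom // (mcharM chid_mchar d%:R).
case: (boolP (nontrivial_mchar chi)) => [chi_nontriv | chi_triv] /=.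
  transitivity (gsum chi ^+ d / q *
      (gsum (chconj (chpow chi d)) * chpow chi d (- (d%:R * lam)))).
    rewrite gsum_chconjV // (mcharN chid_mchar) (mcharM chid_mchar d%:R).
    by rewrite (chpowE_gt0 chi_mchar (-1)) // !expnd exprMn; ring.
  rewrite gsum_chconj_mulN // ?(mcharM chid_mchar d%:R); last first.
    by rewrite mulf_neq0 // natr_dvd_pred_card_neq0.
  by case: (nontrivial_mchar _) => /=; field; rewrite q_neq0 gsum_neq0.
have chi_eps := trivial_mcharE chi_mchar chi_triv.
have chid_eps := chpow_eps d chi_eps.
rewrite (eq_gsum _ (chconj_eps chid_eps)) (eq_gsum _ (chconj_eps chi_eps)).
rewrite (eq_gsum _ chi_eps) (eq_gsum _ chid_eps) !gsum_eps // chi_eps.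
by rewrite /eps oppr_eq0 oner_eq0 mul1r expnd addr0; field.
Qed.

End ProductOfBinomials.

Section GeneratorPowers.
Variables (T : F -> algC) (n : nat).
Hypothesis T_gen : is_char_generator T.
Local Notation d := n.+2.
Hypothesis d_dvd : (d %| N)%N.
Local Notation t := (N %/ d)%N.
Local Notation G k := (gsum (chpow T k)).

Let T_mchar : is_mchar T := proj1 T_gen.

Lemma sum_exceptional_gsum (u : algC) :
  \sum_(j < N) (if nontrivial_mchar (chpow T j) &&
                  ~~ nontrivial_mchar (chpow (chpow T j) d)
               then u * G j ^+ d else 0) =
  u * \sum_(c < n.+1) G (c.+1 * t)%N ^+ d.
Proof.
pose h k := if k == 0%N then 0 else u * G k ^+ d.
transitivity (\sum_(j < N | (t %| j)%N) h j).
  rewrite [RHS]big_mkcond; apply: eq_bigr => j _; rewrite /h.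
  rewrite (eq_nontrivial_mchar (chpow_chpow T j d)) !nontrivial_chpow // negbK.
  have -> : (N %| j * d)%N = (t %| j)%N.
    by rewrite -{1}(divnK d_dvd) dvdn_pmul2r.
  have [-> | j_neq0] := eqVneq (j : nat) 0%N; first by rewrite dvdn0 /= if_same.
  by rewrite gtnNdvd // lt0n.
rewrite (sum_ord_dvd _ (n := d)) ?divn_pred_card_gt0 //; last first.
  by rewrite mulnC divnK.
rewrite big_ord_recl /= {1}/h add0r mulr_sumr.
apply: eq_bigr => c _.
by rewrite /h /bump gtn_eqF // muln_gt0 divn_pred_card_gt0.
Qed.

Local Notation A := (fun i : 'I_n.+1 => chpow T (i.+1 * t)%N).

Lemma greene_summand_gsum lam j : lam != 0 ->
  q ^+ n.+1 * greene_summand A (lam ^- d) (chconj (chpow T j)) =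
  G j ^+ d / G (d * j)%N * chpow T (d * j) (d%:R * lam) +
  if nontrivial_mchar (chpow T j) && ~~ nontrivial_mchar (chpow (chpow T j) d)
  then N%:R / q * G j ^+ d else 0.
Proof.
move=> lam_neq0; have Tj_mchar := is_mchar_chpow j T_mchar.
have Tj_d : chpow (chpow T j) d =1 chpow T (d * j).
  by move=> x; rewrite chpow_chpow mulnC.
have rho_residue := generator_power_residue T_gen d_dvd.
rewrite -(eq_gsum _ Tj_d) -Tj_d
  -(greene_term d_dvd rho_residue Tj_mchar lam_neq0).
rewrite big_add1 big_mkord; congr (_ * (_ * _)); apply: eq_bigr => k _.
by apply: eq_jbinom => // x; rewrite /chmul chpow_chpow mulnC.
Qed.

Lemma greeneF_gsum lam : lam != 0 ->
  q ^+ n * greeneF A (fun=> @eps F) (lam ^- d) =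
  (q - 1)^-1 *
    \sum_(j < N) G j ^+ d / G (d * j)%N * chpow T (d * j) (d%:R * lam)
  + q^-1 * \sum_(c < n.+1) G (c.+1 * t)%N ^+ d.
Proof.
move=> lam_neq0; have q_neq0 := natr_card_neq0 F.
have q1_neq0 : q - 1 != 0 by rewrite -natr_pred_card natr_pred_card_neq0.
pose h := greene_summand A (lam ^- d).
have eq_h := eq_greene_summand A (lam ^- d).
have eq_hconj chi chi' : chi =1 chi' -> h (chconj chi) = h (chconj chi').
  by move=> eq_chi; apply: eq_h => x; rewrite /chconj eq_chi.
rewrite greeneF_eps (sum_char_of_chconj eq_h) (sum_char_of T_gen eq_hconj).
transitivity ((q - 1)^-1 * \sum_(j < N) q ^+ n.+1 * h (chconj (chpow T j))).
  by rewrite -mulr_sumr exprSr; ring.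
under eq_bigr do rewrite greene_summand_gsum //.
rewrite big_split /= sum_exceptional_gsum natr_pred_card mulrDr; congr (_ + _).
by field; rewrite q_neq0 q1_neq0.
Qed.

End GeneratorPowers.

End Greene.

(** * Character sums over powers *)

Section PowerSums.
Variables (F : finFieldType) (d : nat).
Hypothesis d_dvd : (d %| #|F|.-1)%N.
Implicit Types (chi rho psi : F -> algC) (a z : F).

Let d_gt0 : (0 < d)%N := dvdn_pred_card_gt0 d_dvd.

Lemma sum_mchar_expn_eq0 chi (h : F -> algC) z : is_mchar chi ->
  z ^+ d = 1 -> chi z != 1 -> \sum_y chi y * h (y ^+ d) = 0.
Proof.
move=> chi_mchar zd1 chi_z; apply: (fixed_mulr_eq0 chi_z).
have z_neq0 : z != 0.
  by apply: contra_eq_neq zd1 => ->; rewrite expr0n gtn_eqF // eq_sym oner_eq0.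
rewrite mulr_sumr (reindex_inj (mulfI z_neq0)); apply: eq_bigr => y _ /=.
by rewrite (mcharM chi_mchar) exprMn zd1 mul1r mulrA.
Qed.

Lemma sum_chpow_achar_expn psi chi rho a :
  is_mchar chi -> power_residue_mchar d rho -> a != 0 ->
  \sum_y chpow chi d y * psi (a * y ^+ d) =
  \sum_(i < d)
    (chmul (chpow rho i) chi a)^-1 * gsum psi (chmul (chpow rho i) chi).
Proof.
move=> chi_mchar rho_residue a_neq0; pose h y := chi y * psi (a * y).
have rho_i i : is_mchar (chmul (chpow rho i) chi).
  by apply: is_mchar_chmul => //; apply: is_mchar_chpow (proj1 rho_residue).
transitivity (\sum_(y | y != 0) h (y ^+ d)).
  rewrite (bigD1 0) //= chpow_at0 mul0r add0r; apply: eq_bigr => y _.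
  by rewrite /h chpowE_gt0 // mcharX.
rewrite (sum_expn d_dvd h rho_residue).
under eq_bigr do rewrite mulr_sumr.
rewrite exchange_big; apply: eq_bigr => i _ /=.
rewrite -gsum_scale // [RHS](bigD1 0) //= mchar0 // mul0r add0r.
by apply: eq_bigr => y _; rewrite /h /chmul; ring.
Qed.

End PowerSums.

(** * Points off the coordinate hyperplanes *)

Section TorusSum.
Variables (F : finFieldType) (T : F -> algC) (psi : F -> algC).
Hypotheses (T_gen : is_char_generator T) (psi_achar : nontrivial_achar psi).
Variable d : nat.
Hypothesis d_dvd : (d %| #|F|.-1)%N.
Local Notation N := (#|F|.-1).
Local Notation t := (N %/ d)%N.
Local Notation G k := (gsum psi (chpow T k)).
Local Notation Gconj k := (gsum psi (chconj (chpow T k))).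
Implicit Types (w : {ffun 'I_d -> 'I_d}) (x : {ffun 'I_d -> F}) (a c : F)
  (j k : nat).

Let T_mchar : is_mchar T := proj1 T_gen.
Let Tk_mchar k : is_mchar (chpow T k) := is_mchar_chpow k T_mchar.
Let d_gt0 : (0 < d)%N := dvdn_pred_card_gt0 d_dvd.

Definition gauss_prod w j : algC := \prod_(i < d) G (w i * t + j)%N.

Definition power_gsum k a : algC := \sum_y chpow T k y * psi (a * y ^+ d).

Lemma power_gsum_mul j a : a != 0 -> power_gsum (d * j) a =
  (chpow T j a)^-1 * \sum_(i < d) (chpow T (i * t) a)^-1 * G (i * t + j)%N.
Proof.
move=> a_neq0; have rho_residue := generator_power_residue T_gen d_dvd.
have chiE i : chmul (chpow (chpow T t) i) (chpow T j) =1 chpow T (i * t + j).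
  by move=> x; rewrite chpowD /chmul chpow_chpow mulnC.
transitivity (\sum_y chpow (chpow T j) d y * psi (a * y ^+ d)).
  by apply: eq_bigr => y _; rewrite chpow_chpow mulnC.
rewrite (sum_chpow_achar_expn d_dvd psi (Tk_mchar j) rho_residue) // mulr_sumr.
apply: eq_bigr => i _.
by rewrite chiE (eq_gsum _ (chiE i)) chpowD /chmul invfM; ring.
Qed.

Lemma power_gsum_eq0 k a : ~~ (d %| k)%N -> power_gsum k a = 0.
Proof.
move=> d_ndvd; have [g g_prim] := finField_prim_root F.
have g_neq0 := prim_root_pred_card_neq0 g_prim.
have w_prim := dvdn_prim_root g_prim d_dvd.
apply: (sum_mchar_expn_eq0 d_dvd (fun y => psi (a * y)) (Tk_mchar k)
  (prim_expr_order w_prim)).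
rewrite chpowE ?expf_neq0 // -mcharX // generator_eq1 ?expf_neq0 //.
by rewrite -(prim_order_dvd w_prim).
Qed.

Lemma sum_chpow_Wset (g : 'I_d -> algC) :
  \sum_(a | a != 0) (\sum_(i < d) (chpow T (i * t) a)^-1 * g i) ^+ d =
  N%:R * \sum_(w in Wset d) \prod_(i < d) g (w i).
Proof.
pose s w := (\sum_i (w i : nat))%N.
have sum_inv k : \sum_(a | a != 0) (chpow T k a)^-1 =
    if (N %| k)%N then N%:R else 0.
  rewrite -(sum_chpow T_gen) [RHS](reindex_inj invr_inj) /=.
  by apply: eq_big => [b|b _]; rewrite ?invr_eq0 ?mcharV.
transitivity (\sum_(a | a != 0) \sum_w
    (chpow T (s w * t) a)^-1 * \prod_(i < d) g (w i)).
  apply: eq_bigr => a a_neq0.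
  rewrite -[X in _ ^+ X](card_ord d) -prodr_const bigA_distr_bigA.
  apply: eq_bigr => w _; rewrite big_split prodfV /=; congr (_^-1 * _).
  rewrite chpowE // /s big_distrl expr_sum; apply: eq_bigr => i _.
  by rewrite chpowE.
rewrite exchange_big mulr_sumr [RHS]big_mkcond; apply: eq_bigr => w _ /=.
rewrite -mulr_suml sum_inv -{1}(divnK d_dvd) [(s w * t)%N]mulnC.
rewrite dvdn_pmul2l ?divn_pred_card_gt0 // inE /dvdn -/(s w).
by case: ifP => _; rewrite ?mul0r.
Qed.

Definition in_torus x : bool := [forall i, x i != 0].

Lemma sum_torus_prod (R : comNzRingType) (f : F -> R) : f 0 = 0 ->
  \sum_(x | in_torus x) \prod_i f (x i) = (\sum_y f y) ^+ d.
Proof.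
move=> f0; rewrite -[X in _ ^+ X](card_ord d) -prodr_const bigA_distr_bigA.
rewrite big_mkcond; apply: eq_bigr => x _; case: ifPn => //.
case/forallPn=> i; rewrite negbK => /eqP xi0.
by rewrite (bigD1 i) //= xi0 f0 mul0r.
Qed.

Definition torus_sum a c : algC :=
  \sum_(x | in_torus x) psi (a * (\sum_i x i ^+ d - c * \prod_i x i)).

Lemma torus_sum_at0 :
  \sum_(a | a != 0) torus_sum a 0 = N%:R * \sum_(w in Wset d) gauss_prod w 0.
Proof.
rewrite -(sum_chpow_Wset (fun i => G (i * t + 0)%N)).
apply: eq_bigr => a a_neq0.
transitivity (power_gsum (d * 0) a ^+ d); last first.
  by rewrite power_gsum_mul // chpowE // expr0 invr1 mul1r.
rewrite -sum_torus_prod ?chpow_at0 ?mul0r //.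
apply: eq_bigr => x /forallP x_neq0.
rewrite mul0r subr0 mulr_sumr achar_sum //; apply: eq_bigr => i _.
by rewrite muln0 chpowE // expr0 mul1r.
Qed.

Lemma torus_sum_fourier a c : a != 0 -> c != 0 ->
  N%:R * torus_sum a c =
  \sum_(k < N) Gconj k * chpow T k (- (a * c)) * power_gsum k a ^+ d.
Proof.
move=> a_neq0 c_neq0; rewrite mulr_sumr.
under [RHS]eq_bigr => k _
  do rewrite -sum_torus_prod ?chpow_at0 ?mul0r // mulr_sumr.
rewrite exchange_big; apply: eq_bigr => x /forallP x_neq0 /=.
have prod_neq0 : \prod_i x i != 0 by apply/prodf_neq0 => i _.
rewrite mulrBr acharD // [a * \sum_i _]mulr_sumr achar_sum // mulrCA.
have -> : - (a * (c * \prod_i x i)) = - (a * c) * \prod_i x i by ring.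
rewrite (achar_fourier T_gen) ?mulf_neq0 ?oppr_eq0 ?mulf_neq0 // mulr_sumr.
apply: eq_bigr => k _; rewrite big_split /= (mcharM (Tk_mchar k)) mchar_prod //.
by ring.
Qed.

Lemma torus_sum_fourier_dvd a c : a != 0 -> c != 0 ->
  d%:R * (N%:R * torus_sum a c) =
  \sum_(j < N) Gconj (d * j)%N * chpow T (d * j) (- c) *
    (\sum_(i < d) (chpow T (i * t) a)^-1 * G (i * t + j)%N) ^+ d.
Proof.
move=> a_neq0 c_neq0.
pose h k := Gconj k * chpow T k (- (a * c)) * power_gsum k a ^+ d.
have h_per : periodic N h.
  move=> k l eq_kl; rewrite /h (periodic_gsum_chconj T_gen psi eq_kl).
  rewrite (periodic_chpow T_gen _ eq_kl); congr (_ * _ ^+ d).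
  by apply: eq_bigr => y _; rewrite (periodic_chpow T_gen _ eq_kl).
have -> : N%:R * torus_sum a c = \sum_(k < N | (d %| k)%N) h k.
  rewrite torus_sum_fourier // [RHS]big_mkcond; apply: eq_bigr => k _.
  by case: ifPn => // d_ndvd; rewrite power_gsum_eq0 // expr0n gtn_eqF // mulr0.
rewrite mulr_natl sum_periodic_dvd //; apply: eq_bigr => j _; rewrite /h.
rewrite power_gsum_mul // exprMn exprVn -chpowE // chpow_chpow [(j * d)%N]mulnC.
rewrite -mulrN mcharM //; field; exact: mchar_neq0.
Qed.

Lemma torus_sum_total c : c != 0 ->
  d%:R * \sum_(a | a != 0) torus_sum a c =
  \sum_(j < N) Gconj (d * j)%N * chpow T (d * j) (- c) *
    \sum_(w in Wset d) gauss_prod w j.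
Proof.
move=> c_neq0; apply: (mulfI (natr_pred_card_neq0 F)).
rewrite mulrCA !mulr_sumr.
under eq_bigr do rewrite torus_sum_fourier_dvd //.
rewrite exchange_big; apply: eq_bigr => j _ /=; rewrite -mulr_sumr.
by rewrite (sum_chpow_Wset (fun i => G (i * t + j)%N)) mulrCA.
Qed.

End TorusSum.

(** * Projective points and affine cones *)

Section Cone.
Variables (F : finFieldType) (d : nat).
Implicit Types (a b : F) (x y : {ffun 'I_d -> F}) (A : {set {ffun 'I_d -> F}}).

Definition fscale a x : {ffun 'I_d -> F} := [ffun i => a * x i].

Lemma fscaleK a : a != 0 -> cancel (fscale a) (fscale a^-1).
Proof. by move=> a_neq0 x; apply/ffunP => i; rewrite !ffunE mulKf. Qed.

Lemma proj_normalizedP x : reflect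
  (exists2 i, x i = 1 & forall j : 'I_d, (j < i)%N -> x j = 0)
  (proj_normalized x).
Proof.
apply: (iffP existsP) => -[i].
  case/andP=> /eqP xi /forallP x0; exists i => // j lt_ji.
  exact/eqP/(implyP (x0 j)).
move=> xi x0; exists i; rewrite xi eqxx; apply/forallP => j; apply/implyP.
by move/x0/eqP.
Qed.

Lemma fscale_normalized_inj a b x y : a != 0 -> b != 0 ->
  proj_normalized x -> proj_normalized y -> fscale a x = fscale b y ->
  a = b /\ x = y.
Proof.
move=> a_neq0 b_neq0 /proj_normalizedP[i xi x0] /proj_normalizedP[j yj y0]
  /ffunP eq_xy.
have leading k : a * x k = b * y k by have := eq_xy k; rewrite !ffunE.
have eq_ij : i = j.
  apply/val_inj; case: (ltngtP i j) => // lt_ij.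
    by have /eqP := leading i; rewrite xi y0 // mulr0 mulr1 (negPf a_neq0).
  by have /eqP := leading j; rewrite yj x0 // mulr0 mulr1 eq_sym (negPf b_neq0).
have eq_ab : a = b by have := leading i; rewrite xi eq_ij yj !mulr1.
by split=> //; apply/ffunP => k; apply: (mulfI b_neq0); rewrite -leading eq_ab.
Qed.

Lemma fscale_normalize x : x != [ffun=> 0] ->
  exists2 a, a != 0 & proj_normalized (fscale a^-1 x).
Proof.
move=> x_neq0; have [i0 xi0] : exists i, x i != 0.
  apply/existsP; apply: contraNT x_neq0 => /existsPn x0; apply/eqP/ffunP => i.
  by rewrite ffunE; apply/eqP; rewrite -[_ == _]negbK x0.
case: (arg_minnP (P := fun i => x i != 0) (@nat_of_ord d) xi0) => i xi i_min.
exists (x i) => //; apply/proj_normalizedP; exists i => [|j lt_ji].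
  by rewrite ffunE mulVf.
rewrite ffunE; apply/eqP; rewrite mulf_eq0; apply/orP; right.
by apply: contraTT lt_ji => /i_min; rewrite -leqNgt.
Qed.

Lemma card_cone A : [ffun=> 0] \in A ->
  (forall a x, x \in A -> fscale a x \in A) ->
  #|A| = (#|F|.-1 * #|[set x in A | proj_normalized x]|).+1.
Proof.
move=> zero_A scale_A; rewrite (cardsD1 [ffun=> 0]) zero_A add1n; congr _.+1.
rewrite -(cardsC1 (0 : F)) -cardsX
  -(card_in_imset (f := fun ax => fscale ax.1 ax.2)).
  apply: eq_card => x; rewrite in_setD1.
  apply/andP/imsetP => [[x_neq0 xA] | [[a y]]].
    have [a a_neq0 x_norm] := fscale_normalize x_neq0.
    exists (a, fscale a^-1 x); first by rewrite !inE /= a_neq0 scale_A.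
    by rewrite -[a in fscale a]invrK fscaleK // invr_eq0.
  rewrite !inE /= => /andP[a_neq0 /andP[yA /proj_normalizedP[i yi _]]] ->.
  split; last exact: scale_A.
  by apply: contraNneq a_neq0 => /ffunP/(_ i); rewrite !ffunE yi mulr1 => ->.
move=> [a x] [b y]; rewrite !inE /=.
move=> /and3P[a_neq0 _ x_norm] /and3P[b_neq0 _ y_norm].
by case/(fscale_normalized_inj a_neq0 b_neq0 x_norm y_norm) => -> ->.
Qed.

Definition dwork_cone (c : F) : {set {ffun 'I_d -> F}} :=
  [set x : {ffun 'I_d -> F} | \sum_i x i ^+ d == c * \prod_i x i].

Lemma card_dwork_cone lam : (0 < d)%N ->
  #|dwork_cone (d%:R * lam)| = (#|F|.-1 * dwork_count d lam).+1.
Proof.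
move=> d_gt0; rewrite card_cone.
- congr (_ * _).+1; apply: eq_card => x.
  by rewrite !inE andbC.
- rewrite inE big1 => [|i _]; last by rewrite ffunE expr0n gtn_eqF.
  by rewrite (bigD1 (Ordinal d_gt0)) //= ffunE mul0r mulr0.
move=> a x; rewrite !inE => /eqP x_cone.
under [X in X == _]eq_bigr do rewrite ffunE exprMn.
under [X in _ * X]eq_bigr do rewrite ffunE.
by rewrite big_split /= prodr_const card_ord -mulr_sumr x_cone mulrCA.
Qed.

End Cone.

(** * Classes of exponent tuples *)

Section ExponentTuples.
Variable n : nat.
Local Notation d := n.+1.
Implicit Types (w : {ffun 'I_d -> 'I_d}) (c e : 'I_d).

Definition wshift c w : {ffun 'I_d -> 'I_d} := [ffun i => w i + c].

Lemma wshift0 w : wshift 0 w = w.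
Proof. by apply/ffunP => i; rewrite ffunE addr0. Qed.

Lemma wshiftD c e w : wshift c (wshift e w) = wshift (c + e) w.
Proof. by apply/ffunP => i; rewrite !ffunE addrAC addrA. Qed.

Lemma wshiftK c : cancel (wshift c) (wshift (- c)).
Proof. by move=> w; rewrite wshiftD addNr wshift0. Qed.

Lemma val_wshift c w i : (wshift c w i : nat) = ((w i + c) %% d)%N.
Proof. by rewrite ffunE. Qed.

Lemma wshift_Wset c w : (wshift c w \in Wset d) = (w \in Wset d).
Proof.
rewrite !inE; under eq_bigr do rewrite val_wshift.
by rewrite modn_summ big_split /= sum_nat_const card_ord addnC mulnC modnMDl.
Qed.

Lemma const_Wset c : [ffun=> c] \in Wset d.
Proof.
rewrite inE; under eq_bigr do rewrite ffunE.
by rewrite sum_nat_const card_ord modnMr.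
Qed.

Lemma WequivP w w' : reflect (exists c, w = wshift c w') (Wequiv w w').
Proof.
apply: (iffP existsP) => -[c w_w']; exists c.
  apply/ffunP => i; apply: ord_inj; rewrite val_wshift.
  by rewrite (eqP (forallP w_w' i)) modn_small.
by apply/forallP => i; rewrite w_w' val_wshift modn_mod.
Qed.

Lemma Wequiv_refl w : Wequiv w w.
Proof. by apply/WequivP; exists 0; rewrite wshift0. Qed.

Lemma Wequiv_equivalence : {in Wset d & &, equivalence_rel (@Wequiv d)}.
Proof.
move=> w1 w2 w3 _ _ _; split=> [|/WequivP[c ->]]; first exact: Wequiv_refl.
apply/WequivP/WequivP => -[e eq_w]; last first.
  by exists (c + e); rewrite eq_w wshiftD.
by exists (- c + e); rewrite -wshiftD -eq_w wshiftK.
Qed.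

Lemma Wclasses_partition : partition (Wclasses d) (Wset d).
Proof. exact: equivalence_partitionP Wequiv_equivalence. Qed.

Lemma WclassE w : w \in Wset d -> Wclass w = [set wshift c w | c in 'I_d].
Proof.
move=> wW; apply/setP => w'; rewrite inE; apply/andP/imsetP.
  by case=> _ /WequivP[c ->]; exists (- c) => //; rewrite wshiftK.
case=> c _ ->; rewrite wshift_Wset wW; split=> //.
by apply/WequivP; exists (- c); rewrite wshiftK.
Qed.

Lemma card_Wclass w : w \in Wset d -> #|Wclass w| = d.
Proof.
move=> wW; rewrite WclassE // card_imset ?card_ord // => c e /ffunP/(_ ord0).
by rewrite !ffunE => /addrI.
Qed.

Lemma is_zero_classE C : C \in Wclasses d ->
  is_zero_class C = (C == Wclass [ffun=> 0]).
Proof.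
case/imsetP=> w0 w0W ->.
apply/existsP/eqP => [[w /andP[w_w0 /forallP w_eq0]] | ->].
  have w0E : w = [ffun=> 0].
    by apply/ffunP => i; rewrite ffunE; apply/val_inj/eqP/w_eq0.
  move: w_w0; rewrite -w0E inE => /andP[wW w0_w]; apply/setP => w'.
  rewrite ![w' \in Wclass _]in_set; apply: andb_id2l => w'W.
  by have [_ ->] := Wequiv_equivalence w0W wW w'W.
exists [ffun=> 0]; rewrite inE const_Wset Wequiv_refl.
by apply/forallP => i; rewrite ffunE.
Qed.

Section ShiftInvariant.
Variable f : {ffun 'I_d -> 'I_d} -> algC.
Hypothesis f_shift : forall c w, f (wshift c w) = f w.

Lemma sum_Wclass w : w \in Wset d -> \sum_(w' in Wclass w) f w' = d%:R * f w.
Proof.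
move=> wW; rewrite -[d in d%:R](card_Wclass wW) mulr_natl -sumr_const.
by apply: eq_bigr => w'; rewrite WclassE // => /imsetP[c _ ->].
Qed.

Lemma sum_classesE (P : pred {set {ffun 'I_d -> 'I_d}}) :
  d%:R * sum_classes P f = \sum_(C in Wclasses d | P C) \sum_(w in C) f w.
Proof.
rewrite mulr_sumr; apply: eq_bigr => _ /andP[/imsetP[w0 w0W ->] _].
rewrite sum_Wclass //; congr (_ * _); case: pickP => [w | /(_ w0)].
  by rewrite WclassE // => /imsetP[c _ ->].
by rewrite inE w0W Wequiv_refl.
Qed.

Lemma sum_Wset_classes : \sum_(w in Wset d) f w =
  d%:R * (sum_classes (fun C => ~~ is_zero_class C) f + f [ffun=> 0]).
Proof.
rewrite (set_partition_big _ Wclasses_partition) /=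
  (bigID (@is_zero_class d)) /=.
rewrite addrC mulrDr sum_classesE -(sum_Wclass (const_Wset 0)); congr (_ + _).
rewrite (big_pred1 (Wclass [ffun=> 0])) // => C.
rewrite andbC -[RHS]/(C == Wclass [ffun=> 0]).
have zero_class : Wclass [ffun=> 0] \in Wclasses d by apply/imset_f/const_Wset.
have [-> | C_neq0] := eqVneq C (Wclass [ffun=> 0]).
  by rewrite zero_class is_zero_classE // eqxx.
by apply/negP => /andP[C0 CW]; rewrite is_zero_classE // (negPf C_neq0) in C0.
Qed.

End ShiftInvariant.

Lemma sum_Wset_nonzero (R : comNzRingType) (g : 'I_d -> R) :
  \sum_(w in Wset d | [forall i, w i != 0]) \prod_(i < d) g (w i) =
  \sum_(w in Wss d) \prod_(i < d) g (w i) + \sum_(c : 'I_d | c != 0) g c ^+ d.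
Proof.
pose W := {ffun 'I_d -> 'I_d}.
rewrite (bigID (fun w : W => [forall i, forall j, w i == w j])) /= addrC.
congr (_ + _); first by apply: eq_bigl => w; rewrite [in RHS]inE andbA.
rewrite (reindex_onto (fun c : 'I_d => [ffun=> c] : W) (fun w : W => w ord0));
    last first.
  move=> w /andP[_ /forallP w_const]; apply/ffunP => i; rewrite ffunE.
  exact/eqP/(forallP (w_const ord0)).
apply: eq_big => [c | c _]; last first.
  by under eq_bigr do rewrite ffunE; rewrite prodr_const card_ord.
rewrite const_Wset ffunE eqxx andbT.
apply/andP/idP => [[/forallP/(_ ord0)] | c_neq0].
  by rewrite ffunE.
split; apply/forallP => i; rewrite ?ffunE //.
by apply/forallP => j; rewrite !ffunE.
Qed.

End ExponentTuples.

(** * The point count *)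

Section PointCount.
Variables (F : finFieldType) (T : F -> algC) (psi : F -> algC).
Hypotheses (T_gen : is_char_generator T) (psi_achar : nontrivial_achar psi).
Variable n : nat.
Local Notation d := n.+1.
Hypothesis d_dvd : (d %| #|F|.-1)%N.
Local Notation N := (#|F|.-1).
Local Notation q := (#|F|%:R : algC).
Local Notation t := (N %/ d)%N.
Local Notation G k := (gsum psi (chpow T k)).
Local Notation gauss_prod := (gauss_prod T psi).
Local Notation torus_sum := (torus_sum psi d).
Local Notation cone_count c := (#|@dwork_cone F d c|%:R : algC).
Implicit Types (w : {ffun 'I_d -> 'I_d}) (x : {ffun 'I_d -> F}) (e : 'I_d)
  (a c : F).

Let T_mchar : is_mchar T := proj1 T_gen.

Definition gauss_quotient c w : algC :=
  \sum_(j < N) gauss_prod w j / G (d * j)%N * chpow T (d * j) c.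

Lemma periodic_gauss_prod w : periodic N (gauss_prod w).
Proof.
move=> j k eq_jk; apply: eq_bigr => i _; apply: (periodic_gsum_chpow T_gen).
by rewrite -modnDmr eq_jk modnDmr.
Qed.

Lemma gauss_prod_wshift e w j :
  gauss_prod (wshift e w) j = gauss_prod w (j + e * t).
Proof.
apply: eq_bigr => i _; apply: (periodic_gsum_chpow T_gen); rewrite val_wshift.
rewrite muln_modl [(d * t)%N]mulnC divnK // modnDml mulnDl.
by rewrite -addnA [(e * t + j)%N]addnC.
Qed.

Lemma sum_gauss_prod_dvd :
  \sum_(j < N | (t %| j)%N) \sum_(w in Wset d) gauss_prod w j =
  d%:R * \sum_(w in Wset d) gauss_prod w 0.
Proof.
have Nd : N = (d * t)%N by rewrite mulnC divnK.
rewrite (sum_ord_dvd (fun j => \sum_(w in Wset d) gauss_prod w j) Nd)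
  ?divn_pred_card_gt0 //.
transitivity (\sum_(e < d) \sum_(w in Wset d) gauss_prod w 0); last first.
  by rewrite sumr_const card_ord mulr_natl.
apply: eq_bigr => e _.
rewrite [RHS](reindex_inj (can_inj (wshiftK e))).
by apply: eq_big => [w | w _]; rewrite ?wshift_Wset ?gauss_prod_wshift.
Qed.

Lemma gauss_quotient_wshift c e w :
  gauss_quotient c (wshift e w) = gauss_quotient c w.
Proof.
pose f j := gauss_prod w j / G (d * j)%N * chpow T (d * j) c.
have f_per : periodic N f.
  move=> j k eq_jk.
  have eq_djk : d * j = d * k %[mod N] by rewrite -modnMmr eq_jk modnMmr.
  by rewrite /f (periodic_gauss_prod w eq_jk)
    (periodic_gsum_chpow T_gen psi eq_djk) (periodic_chpow T_gen c eq_djk).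
rewrite [RHS]/gauss_quotient -(sum_periodic_shift (e * t) f_per).
apply: eq_bigr => j _.
have eq_dj : d * (j + e * t) = d * j %[mod N].
  by rewrite mulnDr mulnCA [(d * t)%N]mulnC divnK // addnC modnMDl.
by rewrite /f gauss_prod_wshift (periodic_gsum_chpow T_gen psi eq_dj)
  (periodic_chpow T_gen c eq_dj).
Qed.

Lemma natr_eq_achar u v : q * (u == v)%:R = \sum_a psi (a * (u - v)).
Proof.
under eq_bigr do rewrite mulrC; rewrite sum_achar_scale // subr_eq0.
by case: eqP; rewrite ?mulr1 ?mulr0.
Qed.

Lemma cone_count_achar c :
  q * cone_count c = \sum_a \sum_(x : {ffun 'I_d -> F})
    psi (a * (\sum_i x i ^+ d - c * \prod_i x i)).
Proof.
rewrite exchange_big -sum1_card natr_sum mulr_sumr big_mkcond.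
apply: eq_bigr => x _.
by rewrite -natr_eq_achar inE; case: ifP; rewrite ?mulr0.
Qed.

Lemma cone_count_sub0 c :
  q * (cone_count c - cone_count 0) =
  \sum_(a | a != 0) torus_sum a c - \sum_(a | a != 0) torus_sum a 0.
Proof.
rewrite mulrBr !cone_count_achar -!sumrB [RHS]big_mkcond; apply: eq_bigr => a _.
rewrite -!sumrB /torus_sum; case: eqVneq => [-> | _] /=.
  by rewrite big1 // => x _; rewrite !mul0r subrr.
rewrite [RHS]big_mkcond; apply: eq_bigr => x _; case: ifPn => // /forallPn[i].
rewrite negbK => /eqP xi0.
have -> : \prod_i x i = 0 by rewrite (bigD1 i) //= xi0 mul0r.
by rewrite mulr0 mul0r subrr.
Qed.

Lemma cone_count_gauss_quotient c : c != 0 ->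
  d%:R * (cone_count c - cone_count 0) = \sum_(w in Wset d) gauss_quotient c w.
Proof.
move=> c_neq0; apply: (mulfI (natr_card_neq0 F)).
rewrite mulrCA cone_count_sub0 mulrBr.
rewrite (torus_sum_total T_gen) // (torus_sum_at0 T_gen) //.
have reflect j : gsum psi (chconj (chpow T (d * j))) * chpow T (d * j) (- c) =
    q / G (d * j)%N * chpow T (d * j) c + if (t %| j)%N then N%:R else 0.
  rewrite gsum_chconj_mulN ?nontrivial_chpow //; last exact: is_mchar_chpow.
  by rewrite -{1}(divnK d_dvd) mulnC dvdn_pmul2r // if_neg.
under eq_bigr do rewrite reflect mulrDl.
rewrite big_split /= -addrA [X in _ + X](_ : _ = 0) ?addr0.
  rewrite exchange_big mulr_sumr; apply: eq_bigr => j _ /=.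
  by rewrite !mulr_sumr; apply: eq_bigr => w _; ring.
apply/eqP; rewrite subr_eq0 mulrCA -sum_gauss_prod_dvd mulr_sumr.
rewrite [X in _ == X]big_mkcond.
by apply/eqP/eq_bigr => j _; case: ifP; rewrite ?mul0r.
Qed.

Lemma cone_count_classes c : c != 0 -> cone_count c - cone_count 0 =
  sum_classes (fun C => ~~ is_zero_class C) (gauss_quotient c) +
    gauss_quotient c [ffun=> 0].
Proof.
move=> c_neq0; have d_neq0 : d%:R != 0 :> algC by rewrite pnatr_eq0.
apply: (mulfI d_neq0); rewrite cone_count_gauss_quotient // sum_Wset_classes //.
exact: gauss_quotient_wshift.
Qed.

Lemma gauss_quotient0 c : gauss_quotient c [ffun=> 0] =
  \sum_(j < N) G j ^+ d / G (d * j)%N * chpow T (d * j) c.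
Proof.
apply: eq_bigr => j _; congr (_ / _ * _); rewrite /gauss_prod.
by under eq_bigr do rewrite ffunE mul0n add0n; rewrite prodr_const card_ord.
Qed.

Lemma sum_achar_expn a : a != 0 -> \sum_y psi (a * y ^+ d) =
  \sum_(i < d) (chpow T (i * t) a)^-1 * (if i == 0 then 0 else G (i * t)%N).
Proof.
move=> a_neq0; have T0_eps : chpow T 0 =1 @eps F by apply: chpow_dvd (dvdn0 _).
have -> : \sum_y psi (a * y ^+ d) = 1 + power_gsum T psi d (d * 0) a.
  rewrite /power_gsum (bigD1 0) // [in RHS](bigD1 0) //=.
  rewrite muln0 chpow_at0 mul0r add0r.
  rewrite expr0n mulr0 achar0 //; congr (_ + _); apply: eq_bigr => y y_neq0.
  by rewrite chpowE // expr0 mul1r.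
rewrite power_gsum_mul // chpowE // expr0 invr1 mul1r.
rewrite [in RHS]big_ord_recl mulr0 add0r big_ord_recl mul0n addn0.
rewrite (eq_gsum _ T0_eps) gsum_eps // chpowE // expr0 invr1 mul1r.
rewrite addrA subrr add0r.
by apply: eq_bigr => i _; rewrite addn0.
Qed.

Lemma cone_count0 : q * cone_count 0 = q ^+ d + N%:R *
  (\sum_(w in Wss d) \prod_(i < d) G (w i * t)%N +
   \sum_(e : 'I_d | e != 0) G (e * t)%N ^+ d).
Proof.
rewrite -(sum_Wset_nonzero (fun e => G (e * t)%N)).
rewrite cone_count_achar (bigD1 0) //=; congr (_ + _).
  under eq_bigr do rewrite mul0r achar0 //.
  by rewrite sumr_const card_ffun card_ord natrX.
pose g (i : 'I_d) := if i == 0 then 0 else G (i * t)%N.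
transitivity (N%:R * \sum_(w in Wset d) \prod_(i < d) g (w i)); last first.
  congr (_ * _); rewrite [RHS]big_mkcondr; apply: eq_bigr => w _; rewrite /g.
  case: ifPn => [/forallP w_neq0 | /forallPn[i]].
    by apply: eq_bigr => i _; rewrite (negPf (w_neq0 i)).
  by rewrite negbK => wi0; rewrite (bigD1 i) //= wi0 mul0r.
rewrite -(sum_chpow_Wset T_gen d_dvd); apply: eq_bigr => a a_neq0.
rewrite -sum_achar_expn // -[X in _ ^+ X](card_ord d) -prodr_const.
rewrite bigA_distr_bigA; apply: eq_bigr => x _.
by rewrite mul0r subr0 mulr_sumr achar_sum.
Qed.

End PointCount.

Section DworkCount.
Variables (F : finFieldType) (T : F -> algC) (psi : F -> algC) (n : nat).
Hypotheses (T_gen : is_char_generator T) (psi_achar : nontrivial_achar psi).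
Local Notation d := n.+2.
Hypothesis d_dvd : (d %| #|F|.-1)%N.
Local Notation q := (#|F|%:R : algC).
Local Notation t := (#|F|.-1 %/ d)%N.
Local Notation G k := (gsum psi (chpow T k)).

Lemma dwork_count_gsum lam : lam != 0 ->
  (dwork_count d lam)%:R =
    (q ^+ d.-1 - 1) / (q - 1)
  + q ^+ n * greeneF (fun i : 'I_n.+1 => chpow T (i.+1 * t)%N)
                     (fun _ : 'I_n => @eps F) (lam ^- d)
  + q^-1 * \sum_(w in Wss d) \prod_(i < d) G (w i * t)%N
  + (q - 1)^-1 * @sum_classes d (fun C => ~~ is_zero_class C)
      (gauss_quotient T psi (d%:R * lam)).
Proof.
move=> lam_neq0; have q_neq0 := natr_card_neq0 F.
have q1_neq0 : q - 1 != 0 by rewrite -natr_pred_card natr_pred_card_neq0.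
have dlam_neq0 : d%:R * lam != 0.
  by rewrite mulf_neq0 // natr_dvd_pred_card_neq0.
have cone_lam : (#|dwork_cone d (d%:R * lam)|%:R : algC) =
    (q - 1) * (dwork_count d lam)%:R + 1.
  by rewrite card_dwork_cone // -natr1 natrM natr_pred_card.
have cone_diff := cone_count_classes T_gen psi_achar d_dvd dlam_neq0.
have cone0 := cone_count0 T_gen psi_achar d_dvd.
have nonzero_ord : \sum_(e : 'I_d | e != 0) G (e * t)%N ^+ d =
    \sum_(c < n.+1) G (c.+1 * t)%N ^+ d.
  by rewrite big_mkcond big_ord_recl /= add0r.
rewrite nonzero_ord natr_pred_card in cone0.
rewrite (greeneF_gsum psi_achar T_gen d_dvd lam_neq0) -gauss_quotient0.
have -> : (dwork_count d lam)%:R =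
    (#|dwork_cone d (d%:R * lam)|%:R - 1) / (q - 1) :> algC.
  by rewrite cone_lam addrK mulrC mulKf.
rewrite -[#|dwork_cone _ _|%:R](subrK #|@dwork_cone F d 0|%:R) cone_diff.
rewrite -[#|@dwork_cone F d 0|%:R](mulKf q_neq0) cone0 exprS.
by field; rewrite q_neq0 q1_neq0.
Qed.

End DworkCount.

(** * The additive character of the absolute trace *)

Section AbsoluteTrace.
Variables (F : finFieldType) (p : nat) (zeta : algC).
Hypotheses (p_pchar : p \in [pchar F]) (zeta_prim : p.-primitive_root zeta).
Implicit Types x y : F.

Let p_prime : prime p := pcharf_prime p_pchar.

Lemma logn_card_gt0 : (0 < logn p #|F|)%N.
Proof.
have := finNzRing_gt1 F; rewrite {1}(card_pprimeChar p_pchar).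
by case: (logn p _).
Qed.

Lemma trFD : {morph trF p : x y / x + y >-> x + y :> F}.
Proof.
move=> x y; rewrite /trF -big_split; apply: eq_bigr => i _ /=.
by rewrite exprDn_pchar // pnatX (eq_pnat _ (pcharf_eq p_pchar)) pnat_id.
Qed.

Lemma trF_expp x : trF p x ^+ p = trF p x.
Proof.
rewrite -(pFrobenius_autE p_pchar) rmorph_sum /=.
under eq_bigr do rewrite pFrobenius_autE -exprM -expnSr.
rewrite /trF /qF -(prednK logn_card_gt0) big_ord_recr [RHS]big_ord_recl /=.
rewrite prednK ?logn_card_gt0 // -(card_pprimeChar p_pchar) expf_card.
by rewrite addrC.
Qed.

Lemma expp_fixed_natr x : x ^+ p = x -> exists k : 'I_p, k%:R = x.
Proof.
move=> x_fixed.
have [|y ->] := @expf_card_fixed _ _ (in_alg (pPrimeCharType p_pchar)) x.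
  by rewrite card_Fp.
have lt_yp : (y < p)%N by rewrite -[X in (_ < X)%N](Fp_cast p_prime).
by exists (Ordinal lt_yp); rewrite -[y in RHS]natr_Zp rmorph_nat.
Qed.

Lemma tr_natE x : (tr_nat p x)%:R = trF p x.
Proof.
rewrite /tr_nat; case: pickP => [k /eqP // | tr_neq].
have [k tr_k] := expp_fixed_natr (trF_expp x).
by have := tr_neq k; rewrite tr_k eqxx.
Qed.

Lemma eqr_nat_modn k l : (k%:R == l%:R :> F) = (k == l %[mod p]).
Proof.
wlog le_kl : k l / (k <= l)%N => [wlog_le | ].
  case/orP: (leq_total k l) => /wlog_le // eq_lk.
  by rewrite eq_sym eq_lk eq_sym.
by rewrite eq_sym -subr_eq0 -natrB // -(dvdn_pcharf p_pchar) eq_sym eqn_mod_dvd.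
Qed.

Lemma theta_eq x y : (theta p zeta x == theta p zeta y) = (trF p x == trF p y).
Proof. by rewrite (eq_prim_root_expr zeta_prim) -eqr_nat_modn !tr_natE. Qed.

Lemma trF_nontrivial : exists x, trF p x != 0.
Proof.
apply/existsP; apply: contraT => /existsPn tr_eq0; pose n := logn p #|F|.
have n_gt0 : (0 < n)%N := logn_card_gt0.
pose P : {poly F} := \sum_(i < n) 'X^(p ^ i).
have size_P : size P = (p ^ n.-1).+1.
  rewrite /P -(prednK n_gt0) big_ord_recr /= addrC size_polyDl size_polyXn //.
  rewrite ltnS (leq_trans (size_sum _ _ _)) //; apply/bigmax_leqP => i _.
  by rewrite size_polyXn ltn_exp2l ?prime_gt1.
have P_neq0 : P != 0 by rewrite -size_poly_eq0 size_P.
have : (size (enum F) < size P)%N.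
  apply: max_poly_roots P_neq0 _ _; last exact: enum_uniq.
  apply/allP => x _; rewrite rootE horner_sum.
  by under eq_bigr do rewrite hornerXn; have := tr_eq0 x; rewrite negbK.
rewrite size_P -cardE {1}(card_pprimeChar p_pchar).
rewrite ltnS leq_exp2l ?prime_gt1 //.
by rewrite leqNgt ltn_predL n_gt0.
Qed.

Lemma nontrivial_achar_theta : nontrivial_achar (@theta F p zeta).
Proof.
have tr0 : trF p 0 = 0 :> F by apply: (addrI (trF p 0)); rewrite -trFD !addr0.
have theta0 : theta p zeta (0 : F) = 1.
  apply/eqP; rewrite -(prim_order_dvd zeta_prim) (dvdn_pcharf p_pchar).
  by rewrite tr_natE tr0.
split=> // [x y | ].
  apply/eqP; rewrite /theta -exprD (eq_prim_root_expr zeta_prim) -eqr_nat_modn.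
  by rewrite natrD !tr_natE trFD.
by have [x tr_x] := trF_nontrivial; exists x; rewrite -theta0 theta_eq tr0.
Qed.

End AbsoluteTrace.

Theorem theorem8p1 (n : nat) (F : finFieldType) (p : nat)
  (hp : p \in [pchar F])
  (hq : (#|F| = 1 %[mod n.+2])%N)
  (T : F -> algC) (hT : is_char_generator T)
  (zeta : algC) (hzeta : p.-primitive_root zeta)
  (lam : F) (hlam : lam != 0) :
  let d := n.+2 in
  let q := #|F| in
  let t := (q.-1 %/ d)%N in
  (dwork_count d lam)%:R =
    (q%:R ^+ (d.-1) - 1) / (q%:R - 1)
  + q%:R ^+ (d - 2) *
      greeneF (fun i : 'I_n.+1 => chpow T (i.+1 * t)%N)
              (fun _ : 'I_n => @eps F)
              (lam ^- d)
  + q%:R^-1 * \sum_(w in Wss d) \prod_(i < d) gauss p zeta (chpow T (w i * t)%N)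
  + (q%:R - 1)^-1 *
      sum_classes (fun C => ~~ is_zero_class C)
        (fun w => \sum_(j < q.-1)
           (\prod_(i < d) gauss p zeta (chpow T (w i * t + j)%N))
             / gauss p zeta (chpow T (d * j)%N)
           * chpow T (d * j)%N (d%:R * lam)).
Proof.
move=> d q t; have d_dvd : (d %| #|F|.-1)%N.
  by rewrite -subn1 -eqn_mod_dvd ?finField_card_gt0 //; apply/eqP.
have -> : (d - 2 = n)%N by rewrite /d subSS subSS subn0.
by rewrite (dwork_count_gsum hT (nontrivial_achar_theta hp hzeta) d_dvd hlam).
Qed.
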